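(* Let $h(t)=(t+r)^ke^{-\alpha t}$, $t>0$, where $\alpha\in\mathbb{R}$, $r\ge0$, $k\in\mathbb{R}$. If $k<0$, then $\langle h,\bar f\star f\rangle\ge0$ for all $f\in C_0^\infty(\mathbb{R}_+)$. If $k>0$ but $k\notin\mathbb{Z}_+$, then $N_+(h)=[k]/2+1$ and $N_-(h)=\infty$ for even $[k]$, and $N_-(h)=([k]+1)/2$ and $N_+(h)=\infty$ for odd $[k]$.
   Context: $\mathbb{R}_+=(0,\infty)$, $\mathbb{Z}_+=\{0,1,2,\dots\}$, $[k]$ is the integer part of $k$. Here $\langle h,F\rangle=\int_0^\infty h(t)\overline{F(t)}\,dt$ and $(\bar f_1\star f_2)(t)=\int_0^t\overline{f_1(s)}f_2(t-s)\,ds$, so that $\langle h,\bar f\star f\rangle=\int_0^\infty\int_0^\infty h(t+s)f(s)\overline{f(t)}\,ds\,dt$ for $f\in C_0^\infty(\mathbb{R}_+)$. $N_\pm(h)=N_\pm(h;C_0^\infty(\mathbb{R}_+))\in\{0,1,\dots,\infty\}$ is the maximal dimension of linear sets $\mathcal{M}_\pm\subset C_0^\infty(\mathbb{R}_+)$ such that $\pm\langle h,\bar f\star f\rangle>0$ for all $0\ne f\in\mathcal{M}_\pm$. *)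

(* Defs.v *)
From HB Require Import structures.
From mathcomp Require Import all_boot all_order all_algebra.
From mathcomp Require Import complex.
From mathcomp Require Import all_classical all_reals all_analysis.

Set Implicit Arguments.
Unset Strict Implicit.
Unset Printing Implicit Defensive.

Import Order.TTheory GRing.Theory Num.Theory.
Import numFieldNormedType.Exports.

Local Open Scope classical_set_scope.
Local Open Scope ring_scope.
Local Open Scope complex_scope.

(* Lebesgue integral of a complex-valued function on the real line. *)
Definition Cintegral (R : realType) (D : set R) (F : R -> R[i]) : R[i] :=
  Rintegral (@lebesgue_measure R) D (fun t => complex.Re (F t)) +i*
  Rintegral (@lebesgue_measure R) D (fun t => complex.Im (F t)).

Definition smooth (R : realType) (g : R -> R) : Prop :=
  forall (n : nat) (x : R), derivable (derive1n n g) x 1.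

(* Elements of C_0^oo(R_+) are represented by their extensions by zero to the
   whole line: the closed support is a compact subset of the open half-line. *)
Definition test_function (R : realType) : set (R -> R[i]^o) :=
  [set f | [/\ smooth (fun t => complex.Re (f t)),
               smooth (fun t => complex.Im (f t)),
               compact (closure [set t | f t != 0]) &
               closure [set t | f t != 0] `<=` [set` `]0, +oo[ ] ] ].
Arguments test_function : clear implicits.

Definition star (R : realType) (f1 f2 : R -> R[i]) (t : R) : R[i] :=
  Cintegral [set` `[0, t] ] (fun s => f1 s * f2 (t - s)).

Definition pairing (R : realType) (h F : R -> R[i]) : R[i] :=
  Cintegral [set` `]0, +oo[ ] (fun t => h t * conjc (F t)).

(* The bar in <h, fbar * f> is the conjugation inside [star]; [pairing] conjugates
   its second argument once more. *)
Definition hankel_form (R : realType) (h f : R -> R[i]) : R[i] :=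
  pairing h (star (fun t => conjc (f t)) f).

Definition lin_indep (K : fieldType) (V : lmodType K) (n : nat)
    (v : 'I_n -> V) : Prop :=
  forall c : 'I_n -> K, \sum_(i < n) c i *: v i = 0 -> forall i, c i = 0.

(* Dimension of a linear set, +oo when it is not finite-dimensional. *)
Definition dimension (R : realType) (K : fieldType) (V : lmodType K)
    (M : set V) : \bar R :=
  ereal_sup [set (n%:R)%:E | n in
    [set n : nat | exists2 v : 'I_n -> V, lin_indep v & forall i, M (v i)]].

(* The order on R[i] is the partial one: 0 < z means that z is real and
   positive. *)
Definition Nplus (R : realType) (h : R -> R[i]) : \bar R :=
  ereal_sup [set dimension R M | M in
    [set M : set (R -> R[i]^o) | [/\ GRing.submod_closed [in M],
       M `<=` test_function R &
       forall f, M f -> f <> 0 -> 0 < hankel_form h f] ] ].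

Definition Nminus (R : realType) (h : R -> R[i]) : \bar R :=
  ereal_sup [set dimension R M | M in
    [set M : set (R -> R[i]^o) | [/\ GRing.submod_closed [in M],
       M `<=` test_function R &
       forall f, M f -> f <> 0 -> 0 < - hankel_form h f] ] ].

Definition hpow (R : realType) (r k alpha : R) (t : R) : R[i] :=
  ((t + r) `^ k * expR (- alpha * t))%:C.

(* Main.v *)
(*
Put p(s) = (s - 1) / (s + 1 + r). Since
  (2 + r) (s + t + r) = (s + 1 + r) (t + 1 + r) (1 - p(s) p(t)),
the binomial series of (1 - z)^k, whose coefficients are
b_j = prod_{i < j} (i - k) / (i + 1), diagonalises the form:
  <h, fbar * f> = (2 + r)^(-k) sum_j b_j |c_j(f)|^2,
  c_j(f) = int f(s) (s + 1 + r)^k e^(- alpha s) p(s)^j ds;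
the series converges uniformly on compact sets because |p| < 1 on the
half-line. If k < 0, all b_j are positive. If n < k < n + 1, the sign of b_j is
(-1)^j for j <= n + 1 and (-1)^(n + 1) from then on, so that exactly
[n / 2] + 1 of the b_j have the sign (-1)^n. Killing the corresponding c_j bounds
the index of that sign from above. Conversely, any finite set of b_j of a given
sign yields a subspace of that dimension on which the form has this sign:
combinations of point masses at the points where p = rho l, 0 <= l <= N, whose
coefficients are given by an inverse Vandermonde matrix, have a Gram matrix
close to (2 + r)^(-k) diag(b_j) when rho is small, and narrow bumps approximate
point masses.
*)

Require Import Defs.
From HB Require Import structures.
From mathcomp Require Import all_boot all_order all_algebra.
From mathcomp Require Import ring lra.
From mathcomp Require Import complex.
From mathcomp Require Import all_classical all_reals all_analysis.
From mathcomp Require Import measurable_realfun.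
Set Implicit Arguments.
Unset Strict Implicit.
Unset Printing Implicit Defensive.
Import Order.TTheory GRing.Theory Num.Theory.
Import numFieldNormedType.Exports.
Local Open Scope classical_set_scope.
Local Open Scope ring_scope.

(** * Binomial series *)

Section binomial_series.
Context {R : realType}.
Implicit Types (k x y a rho e : R) (i j n N : nat).

(** No infinite series is summed. The expansion enters only through truncations with an error bound
    that is uniform on a box containing the supports; measured against L1 norms, this error does not
    depend on the individual functions.

    The kernel may be unbounded near 0 and at infinity, so no global integrability is available.
    Everything is reduced to bounded measurable functions supported in a segment [A, B] with 0 < A,
    where Fubini and linearity hold freely and |p| stays below some rho < 1. A complex test function
    is split into its real and imaginary parts, and the analysis concerns a real symmetric bilinear
    form.

    For the lower bound the point masses sit near s = 1, the zero of p. Undoing the scale rho of the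
    nodes multiplies the i-th combination by rho^(-i), which is harmless: the truncated kernel with
    N terms is off by rho^(2N) only, while i, j <= N - 1. *)

Definition bcoef k j : R := \prod_(i < j) ((i%:R - k) / i.+1%:R).

Lemma bcoef0 k : bcoef k 0 = 1.
Proof. by rewrite /bcoef big_ord0. Qed.

Lemma bcoefS k j : bcoef k j.+1 = bcoef k j * ((j%:R - k) / j.+1%:R).
Proof. by rewrite /bcoef big_ord_recr. Qed.

Lemma bcoef_gt0 k j : k < 0 -> 0 < bcoef k j.
Proof.
move=> k0; apply: prodr_gt0 => i _; apply: divr_gt0; last by rewrite ltr0n.
by rewrite subr_gt0 (lt_le_trans k0).
Qed.

(** Every factor [i - k] with [i <= n] is negative, so each of the first [n + 1] steps flips the
    sign. *)
Lemma bcoef_alternating k n j : n%:R < k -> (j <= n.+1)%N ->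
  0 < (-1) ^+ j * bcoef k j.
Proof.
move=> nk; elim: j => [|j ih] jn; first by rewrite bcoef0 mulr1 expr0.
have -> : (-1) ^+ j.+1 * bcoef k j.+1 =
    (-1) ^+ j * bcoef k j * ((k - j%:R) / j.+1%:R).
  by rewrite bcoefS exprS; ring.
apply: mulr_gt0; first exact/ih/ltnW.
apply: divr_gt0; last by rewrite ltr0n.
by rewrite subr_gt0 (le_lt_trans _ nk)// ler_nat.
Qed.

(** From index [n + 1] on the new factors are positive, which freezes the sign reached there. *)
Lemma bcoef_eventual_sign k n j : n%:R < k < n.+1%:R -> (n < j)%N ->
  0 < (-1) ^+ n.+1 * bcoef k j.
Proof.
move=> /andP[nk kn]; elim: j => // j ih.
rewrite ltnS leq_eqVlt => /predU1P[nj|nj].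
  by rewrite -nj; apply: bcoef_alternating nk _.
rewrite bcoefS mulrA mulr_gt0 ?ih// divr_gt0 ?ltr0n//.
by rewrite subr_gt0 (lt_le_trans kn)// ler_nat.
Qed.

Definition bpoly k N : {poly R} := \sum_(j < N) bcoef k j *: 'X^j.

Lemma bpolyS k N : bpoly k N.+1 = bpoly k N + bcoef k N *: 'X^N.
Proof. by rewrite /bpoly big_ord_recr. Qed.

Lemma horner_bpoly k N x : (bpoly k N).[x] = \sum_(j < N) bcoef k j * x ^+ j.
Proof. by rewrite /bpoly horner_sum; apply: eq_bigr => j _; rewrite !hornerE. Qed.

(** (1 - x)^k solves (1 - x) y' + k y = 0. For the truncation the recurrence (j + 1) b_(j+1) = (j -
    k) b_j cancels every coefficient except the top one. At [N = 0] the predecessor is 0, but its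
    coefficient vanishes too. *)
Lemma bpoly_ode k N : (1 - 'X) * (bpoly k N)^`() + k *: bpoly k N =
  - (N%:R * bcoef k N) *: 'X^(N.-1).
Proof.
elim: N => [|N ih]; first by rewrite /bpoly big_ord0 deriv0 mulr0 scaler0 add0r mul0r oppr0 scale0r.
rewrite bpolyS derivD derivZ derivXn mulrDr scalerDr addrACA ih bcoefS.
have -> : - (N.+1%:R * (bcoef k N * ((N%:R - k) / N.+1%:R))) = (k - N%:R) * bcoef k N.
  by field; rewrite addrC natr1 pnatr_eq0.
rewrite -!mul_polyC.
case: N {ih} => [|N] /=.
  by rewrite ?(mulr0n, mul0r, mulr0, oppr0, polyC0, polyCM, polyCB, polyCN); ring.
rewrite exprS !(polyCN, polyCM, polyCB) -[_ *+ _]mulr_natr.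
ring.
Qed.

Lemma powR_bounded a lo hi : 0 < lo ->
  exists2 M, 0 < M & forall y, lo <= y <= hi -> y `^ a <= M.
Proof.
(* The first summand is the bound for a nonnegative exponent, the second one for a negative
   exponent. *)
move=> lo0; exists (`|hi| `^ `|a| + (lo `^ `|a|)^-1).
  by rewrite ltr_wpDl ?powR_ge0// invr_gt0 powR_gt0.
move=> y /andP[y1 y2].
have y0 : 0 < y by lra.
case: (lerP 0 a) => a0.
  apply: (@le_trans _ _ (`|hi| `^ `|a|)); last by rewrite lerDl invr_ge0 powR_ge0.
  rewrite (ger0_norm a0) ge0_ler_powR ?nnegrE//; first exact: ltW.
  by rewrite (le_trans y2)// ler_norm.
apply: (@le_trans _ _ (lo `^ `|a|)^-1); last by rewrite lerDr powR_ge0.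
rewrite -[X in y `^ X]opprK powRN lef_pV2 ?posrE ?powR_gt0//.
by rewrite ltr0_norm// ge0_ler_powR// ?nnegrE; lra.
Qed.

(** (1 - x)^(-k) is the integrating factor of [bpoly_ode], so only the defect monomial survives in
    the derivative. *)
Lemma is_derive_bpoly_powR k N x : x < 1 ->
  is_derive x 1 (fun z => (bpoly k N).[z] * (1 - z) `^ (- k))
    (- (N%:R * bcoef k N) * x ^+ N.-1 * (1 - x) `^ (- k - 1)).
Proof.
move=> x1.
have d1 : is_derive x 1 (horner (bpoly k N)) ((bpoly k N)^`()).[x].
  split; first exact: derivable_horner.
  by rewrite -derive1E -derivE.
have d2 : is_derive x 1 (fun z => (1 - z) `^ (- k)) (k * (1 - x) `^ (- k - 1)).
  have x10 : 0 < 1 - x by lra.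
  have := is_derive1_powR (- k) x10 => dp.
  have dl : is_derive x 1 (fun z : R => 1 - z) (-1).
    by have := is_deriveB (is_derive_cst (1:R) x 1) (is_derive_id x 1); rewrite sub0r.
  have := @is_derive1_comp _ (fun z => z `^ (- k)) (fun z => 1 - z) _ _ _ dp dl.
  by move=> h; apply: is_derive_eq; rewrite mulrN1 mulNr opprK.
apply: is_derive_eq.
have := congr1 (fun p => p.[x]) (bpoly_ode k N).
rewrite !hornerE => <-.
have -> : (1 - x) `^ (- k) = (1 - x) * (1 - x) `^ (- k - 1).
  rewrite -{1}(subrK 1 (- k)) powRD; last first.
    by apply/implyP => _; rewrite subr_eq0 gt_eqF.
  by rewrite powRr1 1?mulrC//; lra.
rewrite /GRing.scale /=; ring.
Qed.

(** The product of the truncation with (1 - x)^(-k) equals 1 at 0 and has an explicit derivative of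
    order x^(N-1); the mean value theorem between 0 and x turns this into a remainder of order
    x^N. *)
Lemma binomial_remainder k rho : 0 < rho < 1 -> exists2 C, 0 < C &
  forall N x, (0 < N)%N -> `|x| <= rho ->
    `|(bpoly k N).[x] - (1 - x) `^ k| <= C * (N%:R * `|bcoef k N| * `|x| ^+ N).
Proof.
move=> r01; have /andP[r0 r1] := r01.
have lo0 : 0 < 1 - rho by lra.
have [M1 M10 hM1] := powR_bounded (- k - 1) (1 + rho) lo0.
have [M2 M20 hM2] := powR_bounded k (1 + rho) lo0.
exists (M1 * M2); first exact: mulr_gt0.
move=> N x N0 xr.
pose F := fun z => (bpoly k N).[z] * (1 - z) `^ (- k).
pose dF := fun z => (- (N%:R * bcoef k N) * z ^+ N.-1 * (1 - z) `^ (- k - 1)).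
(* This uses [0 < N]: the empty truncation would give 0. *)
have F0 : F 0 = 1.
  rewrite /F subr0 powR1 mulr1 horner_bpoly.
  case: N N0 {F dF} => // N _; rewrite big_ord_recl big1 ?addr0.
    by rewrite bcoef0 mulr1.
  by move=> i _; rewrite exprS mul0r mulr0.
have Fcont a b : b <= rho -> {within `[a, b], continuous F}.
  move=> br; apply: derivable_within_continuous => z.
  rewrite in_itv /= => /andP[_ zb]; apply: ex_derive.
  by apply: is_derive_bpoly_powR; lra.
have [c cx Fx] : exists2 c, `|c| <= `|x| & F x - F 0 = dF c * x.
  have [x0|x0] := lerP 0 x.
    have [|| c] := @MVT_segment _ F dF 0 x x0.
    - move=> z; rewrite in_itv /= => /andP[_ zb].
      by apply: is_derive_bpoly_powR; move: xr; rewrite ger0_norm//; lra.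
    - by apply: Fcont; move: xr; rewrite ger0_norm.
    rewrite in_itv /= subr0 => /andP[c0 cx] e; exists c => //.
    by rewrite !ger0_norm//; lra.
  have [|| c] := @MVT_segment _ F dF x 0 (ltW x0).
  - move=> z; rewrite in_itv /= => /andP[_ zb].
    by apply: is_derive_bpoly_powR; lra.
  - by apply: Fcont; lra.
  rewrite in_itv /= sub0r => /andP[c0 cx] e; exists c => //.
    by rewrite !ler0_norm//; lra.
  by rewrite -opprB e mulrN opprK.
have xr' := xr; move: xr'; rewrite ler_norml => /andP[xr1 xr2].
have crr : 1 - rho <= 1 - c <= 1 + rho.
  by move: (le_trans cx xr); rewrite ler_norml => /andP[]; lra.
have -> : (bpoly k N).[x] - (1 - x) `^ k = (F x - F 0) * (1 - x) `^ k.
  rewrite F0 /F mulrBl mul1r powRN mulfVK//.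
  by rewrite powR_eq0 negb_and subr_eq0 gt_eqF//; lra.
rewrite Fx /dF !normrM normrN normrM normrX.
rewrite (ger0_norm (powR_ge0 (1 - c) _)) (ger0_norm (powR_ge0 (1 - x) _)) normr_nat.
have h1 := hM1 _ crr.
have h2 : (1 - x) `^ k <= M2 by apply: hM2; apply/andP; split; lra.
have -> : M1 * M2 * (N%:R * `|bcoef k N| * `|x| ^+ N) =
  N%:R * `|bcoef k N| * `|x| ^+ N.-1 * M1 * `|x| * M2.
  have -> : `|x| ^+ N = `|x| * `|x| ^+ N.-1 by rewrite -exprS prednK.
  by ring.
apply: ler_pM => //; rewrite ?powR_ge0 ?mulr_ge0 ?powR_ge0 ?exprn_ge0//.
apply: ler_pM => //; rewrite ?powR_ge0 ?mulr_ge0 ?powR_ge0 ?exprn_ge0//.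
apply: ler_pM => //; rewrite ?powR_ge0 ?mulr_ge0 ?powR_ge0 ?exprn_ge0//.
apply: ler_pM => //; rewrite ?powR_ge0 ?mulr_ge0 ?powR_ge0 ?exprn_ge0//.
by rewrite lerXn2r ?nnegrE.
Qed.

(** Ratio test: consecutive terms have ratio |N - k| rho / N, which tends to rho and so ends up
    below the midpoint [r'] of rho and 1. *)
Lemma bcoef_geometric_decay k rho e : 0 < rho < 1 -> 0 < e ->
  exists2 N, (0 < N)%N & N%:R * `|bcoef k N| * rho ^+ N <= e.
Proof.
move=> /andP[r0 r1] e0.
pose r' := (1 + rho) / 2.
pose a N := N%:R * `|bcoef k N| * rho ^+ N.
have r'0 : 0 < r' by rewrite /r'; lra.
have r'1 : r' < 1 by rewrite /r'; lra.
have rr' : rho < r' by rewrite /r'; lra.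
(* The threshold solves (N + |k|) rho <= N r'. *)
have [N0 hN0] : exists N0 : nat, `|k| * rho / (r' - rho) <= N0%:R.
  by exists (Num.truncn (`|k| * rho / (r' - rho))).+1; apply/ltW; rewrite truncnS_gt.
have step N : (N0 <= N)%N -> a N.+1 <= a N * r'.
  move=> N0N.
  have aN : a N.+1 = `|bcoef k N| * rho ^+ N * (`|N%:R - k| * rho).
    rewrite /a bcoefS !normrM normfV normr_nat exprS.
    by field; rewrite addrC natr1 pnatr_eq0.
  have -> : a N * r' = `|bcoef k N| * rho ^+ N * (N%:R * r') by rewrite /a; ring.
  rewrite aN ler_wpM2l//; first by rewrite mulr_ge0// exprn_ge0// ltW.
  have h1 : `|N%:R - k| * rho <= (N%:R + `|k|) * rho.
    by rewrite ler_pM2r// (le_trans (ler_normB _ _))// normr_nat.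
  apply: (le_trans h1).
  have : `|k| * rho <= N%:R * (r' - rho).
    rewrite -ler_pdivrMr ?subr_gt0// (le_trans hN0)// ler_nat//.
  lra.
have geo m : a (N0 + m)%N <= a N0 * r' ^+ m.
  elim: m => [|m ih]; first by rewrite addn0 mulr1.
  rewrite addnS; apply: (le_trans (step _ (leq_addr _ _))).
  by rewrite exprSr [leRHS]mulrA ler_pM2r.
have a0 N : 0 <= a N by rewrite /a !mulr_ge0// exprn_ge0// ltW.
have : (fun m => a N0 * r' ^+ m) @ \oo --> a N0 * 0.
  apply: cvgMr; apply: cvg_expr; rewrite ger0_norm//; exact: ltW.
rewrite mulr0 => /cvgrPdist_le /(_ e e0)[m _ hm].
(* The successor makes the index positive, as [binomial_remainder] requires. *)
exists (N0 + m.+1)%N; first by rewrite addnS.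
apply: (le_trans (geo _)).
have := hm m.+1 (leqnSn m); rewrite sub0r normrN ger0_norm//.
by rewrite mulr_ge0// exprn_ge0// ltW.
Qed.

End binomial_series.

(** * Smooth functions of compact support *)

Section smooth_functions.
Context {R : realType}.
Implicit Types (f g : R -> R) (p : {poly R}) (x c s : R).

(** Coinduction: a class of differentiable functions that is stable under derivation consists of
    smooth functions, so iterated derivatives need not be computed. *)
Lemma smooth_coind (S : (R -> R) -> Prop) :
  (forall g, S g -> (forall x, derivable g x 1) /\ S (derive1 g)) ->
  forall g, S g -> smooth g.
Proof.
move=> HS g Sg n x.
suff : S (derive1n n g) by move=> /HS[].
by elim: n => // n ih; rewrite derive1nS; case: (HS _ ih).
Qed.

Lemma smooth0 : smooth (fun=> 0 : R).
Proof.
apply: (@smooth_coind (fun g => g = fun=> 0)) => // _ ->.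
split=> [x|]; first exact: derivable_cst.
by apply/funext => x; exact: derive1_cst.
Qed.

Lemma smooth_derive1 g : smooth g -> smooth (derive1 g).
Proof.
move=> sg n x; have := sg n.+1 x.
by rewrite /derive1n iterSr.
Qed.

Lemma smooth_lincomb (a b : R) f g : smooth f -> smooth g ->
  smooth (fun x => a * f x + b * g x).
Proof.
move=> sf sg.
apply: (@smooth_coind (fun h => exists f g,
    [/\ smooth f, smooth g & h = fun x => a * f x + b * g x])); last by exists f, g.
move=> _ [f1 [g1 [sf1 sg1 ->]]].
have df x : is_derive x 1 f1 ((derive1 f1 x)).
  by rewrite derive1E; apply/derivableP; exact: sf1 0 x.
have dg x : is_derive x 1 g1 ((derive1 g1 x)).
  by rewrite derive1E; apply/derivableP; exact: sg1 0 x.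
have dh x : is_derive x 1 (fun x => a * f1 x + b * g1 x) (a * (derive1 f1 x) + b * (derive1 g1 x)).
  have h1 := @is_deriveM _ _ (cst a) f1 x 1 _ _ (is_derive_cst a x 1) (df x).
  have h2 := @is_deriveM _ _ (cst b) g1 x 1 _ _ (is_derive_cst b x 1) (dg x).
  have := is_deriveD h1 h2; rewrite !scaler0 !addr0; exact.
split=> [x|]; first exact: ex_derive.
exists (derive1 f1), (derive1 g1); split; [exact: smooth_derive1..|].
by apply/funext => x; rewrite derive1E; apply: derive_val.
Qed.

Lemma smooth_continuous g : smooth g -> continuous g.
Proof.
by move=> sg x; apply/differentiable_continuous/derivable1_diffP; exact: sg 0 x.
Qed.

(** The classical flat function e^(-1/x), with a polynomial in 1/x in front so that the family is
    stable under derivation. *)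
Definition flat_exp p x : R := if 0 < x then p.[x^-1] * expR (- x^-1) else 0.

(** With y = 1/x, the exponential dominates y^m / m! for m = [size p] + 2. The degree of [p] absorbs
    all but two of these powers, and a bound by x^2 is what makes the difference quotient at 0
    vanish. *)
Lemma flat_exp_le p : exists2 A, 0 < A &
  forall x, 0 < x <= 1 -> `|p.[x^-1]| * expR (- x^-1) <= A * x ^+ 2.
Proof.
pose A := \sum_(i < size p) `|p`_i|.
exists ((A + 1) * (size p).+2`!%:R).
  by rewrite mulr_gt0 ?ltr0n ?fact_gt0// ltr_wpDl// sumr_ge0.
move=> x /andP[x0 x1]; set y := x^-1.
have y0 : 0 < y by rewrite invr_gt0.
have y1 : 1 <= y by rewrite invr_ge1 ?unitfE ?gt_eqF.
have py : `|p.[y]| <= (A + 1) * y ^+ size p.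
  rewrite horner_coef (le_trans (ler_norm_sum _ _ _))// mulrDl mul1r.
  apply: (@le_trans _ _ (A * y ^+ size p)); last by rewrite lerDl exprn_ge0// ltW.
  rewrite /A mulr_suml; apply: ler_sum => i _.
  rewrite normrM ler_wpM2l// normrX gtr0_norm//.
  by rewrite ler_weXn2l// ltnW.
have ey : y ^+ (size p).+2 / (size p).+2`!%:R <= expR y.
  by apply: le_trans (expR_ge1Dxn (size p).+1 (ltW y0)); rewrite lerDr.
rewrite expRN.
apply: (@le_trans _ _ ((A + 1) * y ^+ size p * (y ^+ (size p).+2 / (size p).+2`!%:R)^-1)).
  apply: ler_pM => //.
  by rewrite lef_pV2// posrE ?expR_gt0// divr_gt0// ?exprn_gt0// ltr0n fact_gt0.
have -> : x ^+ 2 = y ^- 2 by rewrite /y exprVn invrK.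
rewrite le_eqVlt; apply/orP; left; apply/eqP.
have F0 : (size p).+2`!%:R != 0 :> R by rewrite pnatr_eq0 -lt0n fact_gt0.
have yn0 : y ^+ size p != 0 by rewrite expf_neq0// gt_eqF.
rewrite 2!exprS expr2 !invfM invrK; field.
by apply/andP; split.
Qed.

Lemma is_derive_flat_exp p x :
  is_derive x 1 (flat_exp p) (flat_exp ('X^2 * (p - p^`())) x).
Proof.
have [x0|x0|->] := ltgtP x 0.
- rewrite /flat_exp ltNge (ltW x0) /=.
  apply: (@near_eq_is_derive _ _ _ (cst 0)).
  near=> z; rewrite /= ltNge ifF//; apply/negbF/ltW; near: z.
  exact: lt_nbhsl.
- have dV : is_derive x 1 (fun z : R => z^-1) (- x ^- 2).
    have := is_deriveV (lt0r_neq0 x0) (is_derive_id x 1).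
    by rewrite /GRing.scale /= mulr1.
  have dp : is_derive (x^-1) 1 (horner p) (p^`()).[x^-1].
    by split; [exact: derivable_horner|rewrite -derive1E -derivE].
  have d1 := is_derive1_comp dp dV.
  have dN : is_derive x 1 (fun z : R => - z^-1) (- - x ^- 2) by exact: is_deriveN.
  have d2 := @is_derive1_comp _ expR (fun z => - z^-1) _ _ _ (is_derive_expR (- x^-1)) dN.
  have d3 := is_deriveM d1 d2.
  suff -> : flat_exp ('X^2 * (p - p^`())) x =
    p.[x^-1] * (expR (- x^-1) * - - x ^- 2) + expR (- x^-1) * (p^`().[x^-1] * - x ^- 2).
    apply: near_eq_is_derive d3.
    near=> z; rewrite /flat_exp ifT//; near: z; exact: lt_nbhsr.
  by rewrite /flat_exp x0 !hornerE /= exprVn; ring.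
- have f0 q : flat_exp q 0 = 0 by rewrite /flat_exp ltxx.
  rewrite f0; apply/is_derive1_caratheodory.
  have [A A0 hA] := flat_exp_le p.
  (* The Caratheodory slope at 0. Division by 0 returns 0, which is the required derivative, and
     [flat_exp_le] bounds the slope by a multiple of z. *)
  exists (fun z => flat_exp p z / z); split.
  + move=> z; rewrite f0 !subr0.
    have [->|z0] := eqVneq z 0; last by rewrite divfK.
    by rewrite f0 mulr0.
  + apply/cvgrPdist_le => e e0; near=> z.
    rewrite f0 mul0r sub0r normrN /flat_exp.
    case: ifPn => z0; last by rewrite mul0r normr0 ltW.
    rewrite normrM normfV normrM (ger0_norm (expR_ge0 _)) (gtr0_norm z0) ler_pdivrMr//.
    apply: (@le_trans _ _ (A * z ^+ 2)).
      apply: hA; rewrite z0 /=; near: z.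
      by near do apply/ltW; apply: lt_nbhsl.
    rewrite expr2 mulrA ler_pM2r// -ler_pdivlMl// mulrC; near: z.
    by near do apply/ltW; apply: lt_nbhsl; rewrite mulr_gt0// invr_gt0.
  + by rewrite f0 mul0r.
Unshelve. all: by end_near. Qed.

(** Bumps are products of atoms, and the product rule also needs sums. The class so generated is
    stable under derivation, as [smooth_coind] demands. *)
Inductive flat_algebra : (R -> R) -> Prop :=
| flat_atom p c s : flat_algebra (fun x => flat_exp p (c + s * x))
| flat_add f g : flat_algebra f -> flat_algebra g -> flat_algebra (f \+ g)
| flat_mul f g : flat_algebra f -> flat_algebra g -> flat_algebra (f \* g).

Lemma smooth_flat_algebra f : flat_algebra f -> smooth f.
Proof.
apply: smooth_coind => {}f hf.
suff [f' hf' df] : exists2 f', flat_algebra f' & forall x, is_derive x 1 f (f' x).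
  split=> [x|]; first by case: (df x).
  suff -> : (derive1 f) = f' by [].
  by apply/funext => x; rewrite derive1E; case: (df x).
elim: hf => [p c s|{}f g _ [f' hf' df] _ [g' hg' dg]|{}f g hf [f' hf' df] hg [g' hg' dg]].
- exists (fun x => flat_exp (s *: ('X^2 * (p - p^`()))) (c + s * x)); first by constructor.
  move=> x.
  have da : is_derive x 1 (fun x => c + s * x) s.
    have h := @is_deriveM _ _ (cst s) id x 1 _ _ (is_derive_cst s x 1) (is_derive_id x 1).
    have := is_deriveD (is_derive_cst c x 1) h.
    by rewrite add0r scaler0 addr0 /GRing.scale /= mulr1.
  have h := @is_derive1_comp _ _ (fun x => c + s * x) _ _ _ (is_derive_flat_exp p (c + s * x)) da.
  apply: (is_derive_eq h).
  rewrite /flat_exp; case: ifP => _; last by rewrite mul0r.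
  by rewrite hornerZ; ring.
- exists (f' \+ g'); first by constructor.
  by move=> x; exact: is_deriveD.
- exists ((f \* g') \+ (g \* f')); first by apply: flat_add; apply: flat_mul.
  by move=> x; exact: is_deriveM.
Qed.

Definition bump c d x : R := flat_exp 1 (x - c) * flat_exp 1 (d - x).

Lemma smooth_bump c d : smooth (bump c d).
Proof.
have -> : bump c d = (fun x => flat_exp 1 (- c + 1 * x)) \* (fun x => flat_exp 1 (d + -1 * x)).
  by apply/funext => x /=; rewrite /bump mul1r mulN1r [- c + x]addrC.
by apply/smooth_flat_algebra/flat_mul; constructor.
Qed.

Lemma flat_exp1_ge0 x : 0 <= flat_exp 1 x.
Proof. by rewrite /flat_exp; case: ifP => // _; rewrite hornerC mul1r expR_ge0. Qed.

Lemma bump_ge0 c d x : 0 <= bump c d x.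
Proof. by rewrite mulr_ge0// flat_exp1_ge0. Qed.

Lemma bump_gt0 c d x : (0 < bump c d x) = (c < x < d).
Proof.
rewrite /bump /flat_exp !subr_gt0 !hornerC !mul1r.
by case: ifP => _; case: ifP => _; rewrite ?mulr0 ?mul0r ?ltxx// mulr_gt0 ?expR_gt0.
Qed.

Lemma bump_supp c d x : bump c d x != 0 -> c <= x <= d.
Proof.
move=> b0; have : 0 < bump c d x by rewrite lt0r b0 bump_ge0.
by rewrite bump_gt0 => /andP[cx xd]; rewrite !ltW.
Qed.

End smooth_functions.

(** * Test functions and their supports *)

Section test_functions.
Context {R : realType}.
Implicit Types f g : R -> R[i].

(** Together with [test_function_supp] this trades the topological support for an explicit segment
    with positive left end, the only form in which supports are used afterwards. *)
Lemma test_function_intro f (A B : R) :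
  smooth (fun t => complex.Re (f t)) -> smooth (fun t => complex.Im (f t)) ->
  0 < A -> (forall t, f t != 0 -> A <= t <= B) -> test_function R f.
Proof.
move=> sRe sIm A0 hf.
have sub : closure [set t | f t != 0] `<=` `[A, B].
  have -> : `[A, B]%classic = closure `[A, B] by rewrite -(closure_id _).1//; exact: interval_closed.
  by apply: closure_subset => t /hf; rewrite /= in_itv.
split => //.
  apply: (subclosed_compact _ (@segment_compact _ A B)) => //.
  exact: closed_closure.
move=> t /sub; rewrite /= !in_itv /= andbT => /andP[At _].
exact: lt_le_trans At.
Qed.

Lemma test_function_supp f : test_function R f ->
  exists2 A, 0 < A & exists B, forall t, f t != 0 -> A <= t <= B.
Proof.
move=> [_ _ cf pf]; set K := closure _ in cf pf.
have sub t : f t != 0 -> K t by move=> ft; exact: subset_closure.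
have [K0|/set0P K0] := eqVneq K set0.
  by exists 1 => //; exists 1 => t /sub; rewrite K0.
have [|c cK hc] := compact_EVT_min (f := @id R) K0 cf.
  by apply: continuous_subspaceT => x; exact: cvg_id.
have [|d dK hd] := compact_EVT_max (f := @id R) K0 cf.
  by apply: continuous_subspaceT => x; exact: cvg_id.
exists c.
  by move: cK; rewrite inE => /pf /=; rewrite in_itv /= andbT.
by exists d => t /sub Kt; rewrite hc ?hd// inE.
Qed.

Lemma test_function_lincomb (a : R[i]) f g : test_function R f ->
  test_function R g -> test_function R (fun t => a * f t + g t).
Proof.
move=> tf tg; have [A A0 [B hf]] := test_function_supp tf.
have [C C0 [D hg]] := test_function_supp tg.
case: tf => sRf sIf _ _; case: tg => sRg sIg _ _.
apply: (@test_function_intro _ (Num.min A C) (Num.max B D)).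
- have -> : (fun t => complex.Re (a * f t + g t)) =
    (fun t => 1 * (complex.Re a * complex.Re (f t) + - complex.Im a * complex.Im (f t))
        + 1 * complex.Re (g t)).
    by apply/funext => t; case: (f t) => u v; case: (g t) => w z; case: a => b c /=; ring.
  by do 2 apply: smooth_lincomb => //.
- have -> : (fun t => complex.Im (a * f t + g t)) =
    (fun t => 1 * (complex.Re a * complex.Im (f t) + complex.Im a * complex.Re (f t))
        + 1 * complex.Im (g t)).
    by apply/funext => t; case: (f t) => u v; case: (g t) => w z; case: a => b c /=; ring.
  by do 2 apply: smooth_lincomb => //.
- by rewrite lt_min A0 C0.
move=> t h.
have [/hf|/negPn/eqP ft] := boolP (f t != 0).
  by move=> /andP[At tB]; rewrite ge_min At le_max tB.
have /hg /andP[Ct tD] : g t != 0 by apply: contra h => /eqP ->; rewrite ft mulr0 addr0.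
by rewrite ge_min Ct le_max tD !orbT.
Qed.

End test_functions.

(** * Integrals of compactly supported functions *)

Section bounded_support.
Context d (T : measurableType d) {R : realType} (mu : {measure set T -> \bar R}).

Lemma integrable_bounded_support (D : set T) (f : T -> R) (M : R) :
  measurable D -> (mu D < +oo)%E -> measurable_fun setT f ->
  (forall x, `|f x| <= M) -> (forall x, f x != 0 -> D x) ->
  mu.-integrable setT (EFin \o f).
Proof.
move=> mD Dfin mf fM fD.
have -> : EFin \o f = (EFin \o f) \_ D.
  apply/funext => x; rewrite patchE; case: ifPn => // /negP xD.
  have [|/negPn/eqP /= ->//] := boolP (f x != 0).
  by move/fD/mem_set.
apply/(integrable_mkcond _ mD)/measurable_bounded_integrable => //.
  exact: measurable_funTS.
exists M; split; first exact: num_real.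
by move=> N MN x _ /=; rewrite (le_trans (fM _))// ltW.
Qed.
End bounded_support.

Section translation.
Context {R : realType}.
Local Notation mu := (@lebesgue_measure R).

(** The translated measure agrees with Lebesgue measure on half-open intervals, and these determine
    it. *)
Lemma lebesgue_measure_shift (a : R) (A : set R) : measurable A ->
  pushforward mu ((fun x => x - a) : _ -> measurableTypeR R) A = mu A.
Proof.
move=> mA; apply/esym/lebesgue_measure_unique => //=.
  by apply: measurable_funB => //; exact: measurable_id.
move=> mf _ [[c d]] _ <-.
rewrite /pushforward.
have -> : (fun x => x - a) @^-1` `]c, d]%classic = `]c + a, d + a]%classic.
  by apply/seteqP; split=> x /=; rewrite !in_itv /= ltrBrDr lerBlDr.
rewrite !lebesgue_measure_itv/= !lte_fin ltrD2r.
by case: ifP => // _; rewrite -!EFinD; congr (_%:E); ring.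
Qed.

Lemma integral_shift (a : R) (f : R -> R) : measurable_fun setT f ->
  mu.-integrable setT (EFin \o (fun x => f (x - a))) ->
  (\int[mu]_x (f (x - a))%:E = \int[mu]_x (f x)%:E)%E.
Proof.
move=> mf intf.
pose phi : measurableTypeR R -> measurableTypeR R := fun x => x - a.
have mphi : measurable_fun [set: measurableTypeR R] phi.
  by apply: measurable_funB => //; exact: measurable_id.
pose g : measurableTypeR R -> \bar R := EFin \o f.
have mg : measurable_fun [set: measurableTypeR R] g by exact/measurable_EFinP.
have := @integral_pushforward _ _ _ _ R phi mphi mu setT g mg _ measurableT.
rewrite preimage_setT => <- //.
by apply: eq_measure_integral => //= A mA _; apply: lebesgue_measure_shift.
Qed.
End translation.

Section compactly_supported.
Context {R : realType}.
Local Notation mu := (@lebesgue_measure R).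
Local Notation mu2 := ((mu \x mu)%E).

(** A class that is stable under all operations needed here and lies inside L1, so that
    integrability never has to be argued case by case; [seg_fun] is its one-dimensional analogue. *)
Definition box_fun (W : R * R -> R) (A B : R) :=
  [/\ measurable_fun setT W, (exists M, forall z, `|W z| <= M) &
    forall z, W z != 0 -> A <= z.1 <= B /\ A <= z.2 <= B].

Definition seg_fun (u : R -> R) (A B : R) :=
  [/\ measurable_fun setT u, (exists M, forall x, `|u x| <= M) &
    forall x, u x != 0 -> A <= x <= B].

Lemma seg_fun_integrable u A B : seg_fun u A B -> mu.-integrable setT (EFin \o u).
Proof.
move=> [mu_ [M uM] us].
refine (@integrable_bounded_support _ _ _ mu `[A, B]%classic u M _ _ mu_ uM _).
- exact: measurable_itv.
- have := @lebesgue_measure_itv R `[A, B]; rewrite /= => ->. 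
  by case: ifP => // _; rewrite -EFinB ltry.
- by move=> x /us; rewrite /= in_itv.
Qed.

Lemma box_fun_integrable W A B : box_fun W A B -> mu2.-integrable setT (EFin \o W).
Proof.
move=> [mW [M WM] Ws].
refine (@integrable_bounded_support _ _ _ mu2 (`[A, B]%classic `*` `[A, B]%classic) W M _ _ mW WM _).
- exact: measurableX.
- apply: (@le_lt_trans _ _ (mu `[A, B] * mu `[A, B])%E).
    by rewrite le_eqVlt; apply/orP; left; apply/eqP; apply: product_measure1E; exact: measurable_itv.
  have := @lebesgue_measure_itv R `[A, B]; rewrite /= => ->.
  case: ifP => // _; last by rewrite mul0e.
  by rewrite -EFinB -EFinM ltry.
- by move=> z /Ws /=; rewrite !in_itv.
Qed.

Lemma box_fun_fubini W A B : box_fun W A B ->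
  Rintegral mu2 setT W =
    fine (\int[mu]_x \int[mu]_y (W (x, y))%:E)%E.
Proof.
by move=> bW; rewrite /Rintegral -integral12_prod_meas1//; exact: box_fun_integrable bW.
Qed.

End compactly_supported.

(** * The pairing with a convolution as a double integral *)

Section convolution.
Context {R : realType}.
Local Notation mu := (@lebesgue_measure R).
Local Notation mu2 := ((mu \x mu)%E).
Implicit Types (W : R * R -> R) (A B : R).

Lemma box_fun_section1 W A B (x : R) : box_fun W A B -> seg_fun (fun y => W (x, y)) A B.
Proof.
move=> [mW [M WM] Ws]; split.
- by apply: measurableT_comp => //; exact: measurable_fun_pair.
- by exists M.
- by move=> y /Ws [].
Qed.

Lemma box_fun_section2 W A B (y : R) : box_fun W A B -> seg_fun (fun x => W (x, y)) A B.
Proof.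
move=> [mW [M WM] Ws]; split.
- by apply: measurableT_comp => //; exact: measurable_fun_pair.
- by exists M.
- by move=> x /Ws [].
Qed.

(** If s and t - s lie in [A, B] with 0 < A, then s and t both lie in [A, 2B]. *)
Lemma box_fun_shear W A B : 0 < A -> box_fun W A B ->
  box_fun (fun z => W (z.2, z.1 - z.2)) A (2 * B).
Proof.
move=> A0 [mW [M WM] Ws]; split.
- apply: measurableT_comp => //; apply: measurable_fun_pair; first exact: measurable_snd.
  by apply: measurable_funB; [exact: measurable_fst|exact: measurable_snd].
- by exists M.
- move=> [x y] /Ws /= [/andP[h1 h2] /andP[h3 h4]].
  by split; apply/andP; split; lra.
Qed.

(** Fubini exchanges the integrals over t and s, and for fixed s the substitution t -> t + s removes
    the shear. The product with [H] is assumed to be a box function because [H] itself may be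
    unbounded. *)
Lemma convolution_pairing (H : R -> R) W A B : 0 < A -> box_fun W A B ->
  box_fun (fun z => H (z.1 + z.2) * W z) A B ->
  Rintegral mu [set` `]0, +oo[]
    (fun t => H t * Rintegral mu [set` `[0, t]] (fun s => W (s, t - s))) =
  Rintegral mu2 setT (fun z => H (z.1 + z.2) * W z).
Proof.
move=> A0 bW bG; set G := fun z => H (z.1 + z.2) * W z.
pose G' (z : R * R) := G (z.2, z.1 - z.2).
have bG' : box_fun G' A (2 * B) := box_fun_shear A0 bG.
have bW' := box_fun_shear A0 bW.
(* Since 0 < A, the integrand lives on 0 < s < t, so restricting to the half-line and to [0, t]
   loses nothing. *)
have W0 s t : W (s, t - s) != 0 -> 0 < s < t.
  by case: bW => _ _ Ws /Ws /= [/andP[h1 h2] /andP[h3 h4]]; apply/andP; split; lra.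
have inner t : (if t \in [set` `]0, +oo[] then
     H t * Rintegral mu [set` `[0, t]] (fun s => W (s, t - s)) else 0) =
   Rintegral mu setT (fun s => G' (t, s)).
  have eG s : G' (t, s) = H t * W (s, t - s) by rewrite /G' /G /= subrKC.
  under [RHS]eq_Rintegral do rewrite eG.
  case: ifPn => [_|].
    rewrite RintegralZl//; last exact: seg_fun_integrable (box_fun_section1 t bW').
    congr (_ * _); rewrite Rintegral_mkcond; apply: eq_Rintegral => s _.
    rewrite patchE; case: ifPn => // /negP st.
    have [/W0 /andP[s0 s1]|/negPn/eqP ->//] := boolP (W (s, t - s) != 0).
    by exfalso; apply: st; rewrite inE /= in_itv /= !ltW.
  rewrite notin_setE /= in_itv /= andbT => /negP; rewrite -leNgt => t0.
  rewrite /Rintegral integral0_eq// => s _.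
  have [/W0 /andP[s0 s1]|/negPn/eqP ->] := boolP (W (s, t - s) != 0); last by rewrite mulr0.
  by move: (lt_trans s0 s1); rewrite ltNge t0.
rewrite Rintegral_mkcond.
transitivity (Rintegral mu setT (fun t => Rintegral mu setT (fun s => G' (t, s)))).
  by apply: eq_Rintegral => t _; rewrite patchE -inner.
rewrite (box_fun_fubini bG) /Rintegral; congr fine.
transitivity (\int[mu]_t \int[mu]_s (G' (t, s))%:E)%E.
  apply: eq_integral => t _; rewrite fineK//.
  by apply: integrable_fin_num => //; exact: seg_fun_integrable (box_fun_section1 t bG').
transitivity (\int[mu]_s \int[mu]_t (G' (t, s))%:E)%E.
  exact: (Fubini (box_fun_integrable bG')).
apply: eq_integral => s _.
rewrite -(integral_shift (a := s) (f := fun t => G (s, t)))//.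
- by case: (box_fun_section1 s bG).
- exact: seg_fun_integrable (box_fun_section2 s bG').
Qed.

End convolution.

(** * Bilinear forms given by kernels *)

Section kernel_forms.
Context {R : realType}.
Local Notation mu := (@lebesgue_measure R).
Local Notation mu2 := ((mu \x mu)%E).
Implicit Types (u v : R -> R) (K : R * R -> R) (A B : R).

Definition tensor u v (z : R * R) := u z.1 * v z.2.

Definition kform K u v := Rintegral mu2 setT (fun z => K z * tensor u v z).

Lemma seg_fun_widen u A B A' B' : seg_fun u A B -> A' <= A -> B <= B' -> seg_fun u A' B'.
Proof.
move=> [mu_ bu us] AA BB; split=> // x /us /andP[Ax xB].
by rewrite (le_trans AA Ax) (le_trans xB BB).
Qed.

Lemma seg_fun_lincomb (a : R) u v A B : seg_fun u A B -> seg_fun v A B ->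
  seg_fun (fun x => a * u x + v x) A B.
Proof.
move=> [mu_ [M uM] us] [mv [N vN] vs]; split.
- by apply: measurable_funD => //; apply: measurable_funM => //; exact: measurable_cst.
- exists (`|a| * M + N) => x; rewrite (le_trans (ler_normD _ _))// lerD// normrM.
  by rewrite ler_wpM2l.
- move=> x h; have [/us//|/negPn/eqP u0] := boolP (u x != 0).
  by apply: vs; move: h; rewrite u0 mulr0 add0r.
Qed.

Lemma seg_fun_norm u A B : seg_fun u A B -> seg_fun (fun x => `|u x|) A B.
Proof.
move=> [mu_ [M uM] us]; split.
- exact: measurableT_comp.
- by exists M => x; rewrite normr_id.
- by move=> x; rewrite normr_eq0; exact: us.
Qed.

Lemma seg_fun_mul (g u : R -> R) A B (N : R) : measurable_fun setT g ->
  (forall x, A <= x <= B -> `|g x| <= N) -> seg_fun u A B ->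
  seg_fun (fun x => g x * u x) A B.
Proof.
move=> mg gN [mu_ [M uM] us]; split.
- exact: measurable_funM.
- exists (`|N| * `|M|) => x; have [->|u0] := eqVneq (u x) 0.
    by rewrite mulr0 normr0 mulr_ge0.
  rewrite normrM ler_pM//; last by rewrite (le_trans (uM x))// ler_norm.
  by rewrite (le_trans (gN _ (us _ u0)))// ler_norm.
- move=> x h; apply: us; apply: contra h => /eqP ->; by rewrite mulr0.
Qed.

Lemma box_fun_mul K (W : R * R -> R) A B (N : R) : measurable_fun setT K ->
  (forall x y, A <= x <= B -> A <= y <= B -> `|K (x, y)| <= N) -> box_fun W A B ->
  box_fun (fun z => K z * W z) A B.
Proof.
move=> mK KN [mW [M WM] Ws]; split.
- exact: measurable_funM.
- exists (`|N| * `|M|) => z; have [->|W0] := eqVneq (W z) 0.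
    by rewrite mulr0 normr0 mulr_ge0.
  rewrite normrM ler_pM//; last by rewrite (le_trans (WM z))// ler_norm.
  have [z1 z2] := Ws _ W0.
  by rewrite {1}(surjective_pairing z) (le_trans (KN _ _ z1 z2))// ler_norm.
- move=> z h; apply: Ws; apply: contra h => /eqP ->; by rewrite mulr0.
Qed.

Lemma box_fun_tensor u v A B : seg_fun u A B -> seg_fun v A B ->
  box_fun (tensor u v) A B.
Proof.
move=> [mu_ [M uM] us] [mv [N vN] vs]; split.
- apply: measurable_funM.
    by apply: (measurableT_comp mu_); exact: measurable_fst.
  by apply: (measurableT_comp mv); exact: measurable_snd.
- by exists (M * N) => z; rewrite normrM ler_pM.
- move=> z; rewrite mulf_eq0 negb_or => /andP[uz vz].
  by split; [exact: us|exact: vs].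
Qed.

Lemma box_fun_lincomb (a : R) (V W : R * R -> R) A B : box_fun V A B -> box_fun W A B ->
  box_fun (fun z => a * V z + W z) A B.
Proof.
move=> [mV [M VM] Vs] [mW [N WN] Ws]; split.
- by apply: measurable_funD => //; apply: measurable_funM => //; exact: measurable_cst.
- exists (`|a| * M + N) => x; rewrite (le_trans (ler_normD _ _))// lerD// normrM.
  by rewrite ler_wpM2l.
- move=> x h; have [/Vs//|/negPn/eqP u0] := boolP (V x != 0).
  by apply: Ws; move: h; rewrite u0 mulr0 add0r.
Qed.

Lemma Rintegral_box_lincomb (a : R) (V W : R * R -> R) A B :
  box_fun V A B -> box_fun W A B ->
  Rintegral mu2 setT (fun z => a * V z + W z) =
  a * Rintegral mu2 setT V + Rintegral mu2 setT W.
Proof.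
move=> bV bW; have iV := box_fun_integrable bV; have iW := box_fun_integrable bW.
rewrite RintegralD//; first by rewrite RintegralZl.
exact: (integrableZl measurableT a iV).
Qed.

Lemma Rintegral_seg_lincomb (a : R) u v A B :
  seg_fun u A B -> seg_fun v A B ->
  Rintegral mu setT (fun z => a * u z + v z) =
  a * Rintegral mu setT u + Rintegral mu setT v.
Proof.
move=> bu bv; have iu := seg_fun_integrable bu; have iv := seg_fun_integrable bv.
rewrite RintegralD//; first by rewrite RintegralZl.
exact: (integrableZl measurableT a iu).
Qed.

Lemma Rintegral_tensor u v A B : seg_fun u A B -> seg_fun v A B ->
  Rintegral mu2 setT (tensor u v) = Rintegral mu setT u * Rintegral mu setT v.
Proof.
move=> su sv; rewrite (box_fun_fubini (box_fun_tensor su sv)).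
rewrite -RintegralZr//; last exact: seg_fun_integrable su.
congr fine; apply: eq_integral => x _.
have iv := seg_fun_integrable sv.
rewrite /tensor /=; under eq_integral do rewrite EFinM.
rewrite integralZl//= EFinM /Rintegral fineK//.
exact: integrable_fin_num.
Qed.

Lemma Rintegral_box_swap (W : R * R -> R) A B : box_fun W A B ->
  Rintegral mu2 setT (fun z => W (z.2, z.1)) = Rintegral mu2 setT W.
Proof.
move=> bW.
have bW' : box_fun (fun z => W (z.2, z.1)) A B.
  case: (bW) => mW [M WM] Ws; split; last by move=> z /Ws [].
    apply: measurableT_comp => //; apply: measurable_fun_pair; first exact: measurable_snd.
    exact: measurable_fst.
  by exists M.
rewrite (box_fun_fubini bW') (box_fun_fubini bW); congr fine.
by rewrite -(Fubini (box_fun_integrable bW)).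
Qed.

(** Kernels are compared only where the functions live. The estimate serves both to truncate the
    expansion and to replace narrow bumps by point masses. *)
Lemma kform_close K1 K2 u v A B (e : R) : seg_fun u A B -> seg_fun v A B ->
  box_fun (fun z => K1 z * tensor u v z) A B ->
  box_fun (fun z => K2 z * tensor u v z) A B ->
  (forall s t, u s != 0 -> v t != 0 -> `|K1 (s, t) - K2 (s, t)| <= e) ->
  `|kform K1 u v - kform K2 u v| <=
     e * (Rintegral mu setT (fun x => `|u x|) * Rintegral mu setT (fun x => `|v x|)).
Proof.
move=> su sv b1 b2 K12.
have i1 := box_fun_integrable b1; have i2 := box_fun_integrable b2.
have nu := seg_fun_norm su; have nv := seg_fun_norm sv.
have bn := box_fun_integrable (box_fun_tensor nu nv).
rewrite /kform -RintegralB//.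
have ib : mu2.-integrable setT
    (EFin \o (fun z => K1 z * tensor u v z - K2 z * tensor u v z)).
  exact: (integrableB measurableT i1 i2).
apply: (le_trans (le_normr_Rintegral _ ib)) => //.
rewrite -(Rintegral_tensor nu nv) -RintegralZl//.
apply: le_Rintegral => //.
- exact: (integrable_norm ib).
- exact: (integrableZl measurableT e bn).
- move=> [s t] _; rewrite -mulrBl normrM /tensor /= normrM.
  have [->|us] := eqVneq (u s) 0; first by rewrite normr0 !mul0r !mulr0.
  have [->|vt] := eqVneq (v t) 0; first by rewrite normr0 !mulr0.
  by rewrite ler_wpM2r ?mulr_ge0// K12.
Qed.

End kernel_forms.

(** * The kernel of the form *)

Section hankel_kernel.
Context {R : realType}.
Variables (r k alpha : R).
Hypothesis hr : 0 <= r.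
Local Notation mu := (@lebesgue_measure R).
Implicit Types (u v : R -> R) (A B s t : R).

Definition hreal t := (t + r) `^ k * expR (- alpha * t).

Definition bform u v := kform (fun z => hreal (z.1 + z.2)) u v.

(* The power [-1] rather than the inverse makes measurability immediate. *)
Definition cayley s := (s - 1) * (s + 1 + r) `^ (-1).

Definition weight s := (s + 1 + r) `^ k * expR (- alpha * s).

Definition moment j u := Rintegral mu setT (fun s => weight s * cayley s ^+ j * u s).

Definition partial_kernel N (z : R * R) := \sum_(j < N) (2 + r) `^ (- k) * bcoef k j *
  tensor (fun s => weight s * cayley s ^+ j) (fun s => weight s * cayley s ^+ j) z.

Lemma measurable_affine_powR (c p : R) : measurable_fun setT (fun s : R => (s + c) `^ p).
Proof.
apply: (measurableT_comp (measurable_powR _)).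
by apply: measurable_funD => //; exact: measurable_id.
Qed.

Lemma measurable_expR_scale (c : R) : measurable_fun setT (fun s : R => expR (c * s)).
Proof.
apply: (measurableT_comp (@measurable_expR R)).
by apply: measurable_funM => //; exact: measurable_id.
Qed.

Lemma measurable_hreal : measurable_fun setT hreal.
Proof. by apply: measurable_funM; [exact: measurable_affine_powR|exact: measurable_expR_scale]. Qed.

Lemma measurable_weight : measurable_fun setT weight.
Proof.
apply: measurable_funM; last exact: measurable_expR_scale.
rewrite (_ : (fun s => _) = (fun s : R => (s + (1 + r)) `^ k)); first exact: measurable_affine_powR.
by apply/funext => s; rewrite addrA.
Qed.

Lemma measurable_cayley : measurable_fun setT cayley.
Proof.
apply: measurable_funM.
  by apply: measurable_funB => //; exact: measurable_id.
rewrite (_ : (fun s => _) = (fun s : R => (s + (1 + r)) `^ (-1))); first exact: measurable_affine_powR.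
by apply/funext => s; rewrite addrA.
Qed.

Lemma expR_scale_bounded (c A B : R) : exists2 M, 0 < M &
  forall s, A <= s <= B -> expR (c * s) <= M.
Proof.
exists (expR (`|c| * (`|A| + `|B|))); first exact: expR_gt0.
move=> s /andP[As sB]; rewrite ler_expR (le_trans (ler_norm _))// normrM ler_wpM2l//.
rewrite ler_norml; apply/andP; split.
  have := lerNnormlW (lexx `|A|); have := normr_ge0 B; lra.
by have := ler_norm B; have := normr_ge0 A; lra.
Qed.

Lemma weight_bounded A B : 0 < A -> exists2 M, 0 < M &
  forall s, A <= s <= B -> 0 <= weight s <= M.
Proof. have hr0 := hr.
move=> A0; have lo : 0 < A + 1 + r by lra.
have [M M0 hM] := powR_bounded k (B + 1 + r) lo.
have [N N0 hN] := expR_scale_bounded (- alpha) A B.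
exists (M * N); first exact: mulr_gt0.
move=> s sAB; rewrite mulr_ge0 ?powR_ge0 ?expR_ge0//= ler_pM ?powR_ge0 ?expR_ge0 ?hN//.
by apply: hM; lra.
Qed.

Lemma hreal_bounded A B : 0 < A -> exists2 M, 0 < M &
  forall s, A <= s <= B -> `|hreal s| <= M.
Proof. have hr0 := hr.
move=> A0; have lo : 0 < A + r by lra.
have [M M0 hM] := powR_bounded k (B + r) lo.
have [N N0 hN] := expR_scale_bounded (- alpha) A B.
exists (M * N); first exact: mulr_gt0.
move=> s sAB; rewrite ger0_norm ?mulr_ge0 ?powR_ge0 ?expR_ge0//.
rewrite ler_pM ?powR_ge0 ?expR_ge0 ?hN//.
by apply: hM; lra.
Qed.

Lemma cayleyE s : 0 < s -> cayley s = (s - 1) / (s + 1 + r).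
Proof. have hr0 := hr. by move=> s0; rewrite /cayley powR_inv1//; lra. Qed.

Lemma cayley_bounded A B : 0 < A -> exists2 rho, 0 < rho < 1 &
  forall s, A <= s <= B -> `|cayley s| <= rho.
Proof. have hr0 := hr.
move=> A0; have [AB|BA] := lerP A B; last first.
  by exists (1 / 2); [lra|move=> s; lra].
have B0 : 0 < B + 1 + r by lra.
(* The bound |s - 1| <= s + 1 + r - A' needs A' <= 1 when s >= 1 and A' <= s when s < 1; dividing by
   s + 1 + r <= B + 1 + r then gives rho. *)
pose A' := Num.min A 1.
have A'A : A' <= A by rewrite ge_min lexx.
have A'1 : A' <= 1 by rewrite ge_min lexx orbT.
have A'0 : 0 < A' by rewrite lt_min A0 ltr01.
exists (1 - A' / (B + 1 + r)).
  rewrite subr_gt0 ltr_pdivrMr// ltrBlDr ltrDl divr_gt0// andbT; lra.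
move=> s /andP[As sB]; have s0 : 0 < s + 1 + r by lra.
rewrite cayleyE; last lra.
have h : A' / (B + 1 + r) <= A' / (s + 1 + r).
  by rewrite ler_pM2l// lef_pV2 ?posrE//; lra.
apply: (@le_trans _ _ (1 - A' / (s + 1 + r))); last by rewrite lerD2l lerN2.
have -> : 1 - A' / (s + 1 + r) = (s + 1 + r - A') / (s + 1 + r).
  by field; rewrite gt_eqF.
rewrite normrM normfV (gtr0_norm s0) ler_pM2r ?invr_gt0//.
by rewrite ler_norml; apply/andP; split; lra.
Qed.

(* [(2 + r) (s + t + r) = (s + 1 + r) (t + 1 + r) (1 - cayley s * cayley t)] *)
Lemma hreal_factor s t : 0 < s -> 0 < t ->
  hreal (s + t) = (2 + r) `^ (- k) * (weight s * weight t) * (1 - cayley s * cayley t) `^ k.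
Proof. have hr0 := hr.
move=> s0 t0; rewrite /hreal /weight !cayleyE//.
have s1 : 0 < s + 1 + r by lra.
have t1 : 0 < t + 1 + r by lra.
have r2 : 0 < 2 + r by lra.
have -> : 1 - (s - 1) / (s + 1 + r) * ((t - 1) / (t + 1 + r)) =
    (2 + r) * (s + t + r) / ((s + 1 + r) * (t + 1 + r)).
  by field; rewrite !gt_eqF.
have P1 : (s + 1 + r) `^ k != 0 by rewrite gt_eqF// powR_gt0.
have P2 : (t + 1 + r) `^ k != 0 by rewrite gt_eqF// powR_gt0.
have P3 : (2 + r) `^ k != 0 by rewrite gt_eqF// powR_gt0.
have -> : ((2 + r) * (s + t + r) / ((s + 1 + r) * (t + 1 + r))) `^ k =
    (2 + r) `^ k * (s + t + r) `^ k / ((s + 1 + r) `^ k * (t + 1 + r) `^ k).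
  rewrite powRM; last 2 first.
  - by rewrite mulr_ge0//; lra.
  - by rewrite invr_ge0 mulr_ge0//; lra.
  rewrite powRM; [|lra..]; congr (_ * _).
  rewrite -powR_inv1; last by rewrite mulr_ge0//; lra.
  rewrite powRAC -powR_inv1 ?powR_ge0//; last by rewrite mulr_ge0// powR_ge0.
  by rewrite powRM//; lra.
rewrite mulrDr expRD powRN; field.
by rewrite P1 P2 P3.
Qed.

Lemma partial_kernel_cvg A B (e : R) : 0 < A -> 0 < e -> exists N, forall s t,
  A <= s <= B -> A <= t <= B ->
  `|hreal (s + t) - partial_kernel N (s, t)| <= e.
Proof. have hr0 := hr.
move=> A0 e0.
have [rho r01 hrho] := cayley_bounded B A0.
have [M M0 hM] := weight_bounded B A0.
have [C C0 hC] := binomial_remainder k r01.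
have K0 : 0 < (2 + r) `^ (- k) by rewrite powR_gt0//; lra.
(* The prefactor of the kernel, two weights and the constant of the remainder are divided out in
   advance. *)
have e1 : 0 < e / ((2 + r) `^ (- k) * (M * M) * C) by rewrite divr_gt0// !mulr_gt0.
have [N N0 hN] := bcoef_geometric_decay k r01 e1.
exists N => s t sAB tAB.
have s0 : 0 < s by lra.
have t0 : 0 < t by lra.
have /andP[ws0 wsM] := hM _ sAB.
have /andP[wt0 wtM] := hM _ tAB.
have /andP[rho0 rho1] := r01.
have x_rho : `|cayley s * cayley t| <= rho.
  rewrite normrM -[leRHS]mulr1 ler_pM ?hrho//.
  by rewrite (le_trans (hrho _ tAB))// ltW.
rewrite hreal_factor//.
have -> : partial_kernel N (s, t) = (2 + r) `^ (- k) * (weight s * weight t) *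
    (bpoly k N).[cayley s * cayley t].
  rewrite /partial_kernel horner_bpoly mulr_sumr; apply: eq_bigr => j _.
  by rewrite /tensor /= (exprMn _ (cayley s)); ring.
rewrite distrC -mulrBr normrM.
have := hC N _ N0 x_rho; set x := _ * cayley t => hx.
apply: (@le_trans _ _ ((2 + r) `^ (- k) * (M * M) * (C * (N%:R * `|bcoef k N| * rho ^+ N)))).
  apply: ler_pM => //.
    rewrite ger0_norm ?mulr_ge0 ?powR_ge0// ler_wpM2l ?powR_ge0//.
    by rewrite ler_pM.
  apply: (le_trans hx); rewrite ler_wpM2l ?(ltW C0)//.
  by rewrite ler_wpM2l ?mulr_ge0// lerXn2r// nnegrE ltW.
by rewrite mulrA -ler_pdivlMl ?mulr_gt0// [leRHS]mulrC.
Qed.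

Lemma seg_fun_moment u A B j : 0 < A -> seg_fun u A B ->
  seg_fun (fun s => weight s * cayley s ^+ j * u s) A B.
Proof.
move=> A0 su.
have [rho /andP[r0 r1] hrho] := cayley_bounded B A0.
have [M M0 hM] := weight_bounded B A0.
apply: (@seg_fun_mul _ _ _ _ _ M) => //.
  apply: measurable_funM; first exact: measurable_weight.
  by apply: measurable_funX; exact: measurable_cayley.
move=> s sAB; have /andP[w0 wM] := hM _ sAB.
rewrite normrM (ger0_norm w0) -[leRHS]mulr1 ler_pM// normrX exprn_ile1//.
by rewrite (le_trans (hrho _ sAB))// ltW.
Qed.

Lemma moment_lincomb (a : R) u v A B j : 0 < A -> seg_fun u A B -> seg_fun v A B ->
  moment j (fun x => a * u x + v x) = a * moment j u + moment j v.
Proof.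
move=> A0 su sv; rewrite /moment.
rewrite -(Rintegral_seg_lincomb a (seg_fun_moment j A0 su) (seg_fun_moment j A0 sv)).
by apply: eq_Rintegral => x _; ring.
Qed.

Lemma box_fun_hreal W A B : 0 < A -> box_fun W A B ->
  box_fun (fun z => hreal (z.1 + z.2) * W z) A B.
Proof.
move=> A0; have A20 : 0 < 2 * A by lra.
have [M M0 hM] := hreal_bounded (2 * B) A20.
apply: (@box_fun_mul _ _ _ _ _ M) => [|x y xAB yAB]; last by apply: hM => /=; lra.
apply: (measurableT_comp measurable_hreal).
by apply: measurable_funD; [exact: measurable_fst|exact: measurable_snd].
Qed.

(** Each term is a product kernel and integrates to a product of moments. The box property is proved
    in the same induction because adding the next term under the integral relies on it. *)
Lemma partial_kernel_form u v A B N : 0 < A -> seg_fun u A B -> seg_fun v A B ->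
  box_fun (fun z => partial_kernel N z * tensor u v z) A B /\
  kform (partial_kernel N) u v =
    \sum_(j < N) (2 + r) `^ (- k) * bcoef k j * (moment j u * moment j v).
Proof.
move=> A0 su sv; elim: N => [|N [ihb ih]].
  have E : (fun z => partial_kernel 0 z * tensor u v z) = cst 0.
    by apply/funext => z; rewrite /partial_kernel big_ord0 mul0r.
  split.
    rewrite E; split; first exact: measurable_cst.
      by exists 0 => z; rewrite normr0.
    by move=> z; rewrite eqxx.
  by rewrite big_ord0 /kform E Rintegral_cst// mul0r.
have E : (fun z => partial_kernel N.+1 z * tensor u v z) =
  (fun z => (2 + r) `^ (- k) * bcoef k N *
    tensor (fun s => weight s * cayley s ^+ N * u s) (fun s => weight s * cayley s ^+ N * v s) z +
    partial_kernel N z * tensor u v z).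
  by apply/funext => z; rewrite /partial_kernel big_ord_recr /= /tensor; ring.
have su' := seg_fun_moment N A0 su; have sv' := seg_fun_moment N A0 sv.
have bT := box_fun_tensor su' sv'.
split; first by rewrite E; exact: box_fun_lincomb.
rewrite /kform E (Rintegral_box_lincomb _ bT ihb) (Rintegral_tensor su' sv').
by rewrite big_ord_recr /= addrC -ih.
Qed.

(** The order of quantifiers is the point: [N] depends on the segment and on the precision, not on
    the functions. *)
Lemma bform_approx A B (e : R) : 0 < A -> 0 < e -> exists N, forall u v,
  seg_fun u A B -> seg_fun v A B ->
  `|bform u v - \sum_(j < N) (2 + r) `^ (- k) * bcoef k j * (moment j u * moment j v)| <=
  e * (Rintegral mu setT (fun x => `|u x|) * Rintegral mu setT (fun x => `|v x|)).
Proof.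
move=> A0 e0; have [N hN] := partial_kernel_cvg B A0 e0.
exists N => u v su sv; have [bN <-] := partial_kernel_form N A0 su sv.
apply: (kform_close su sv _ bN); first exact: box_fun_hreal (box_fun_tensor su sv).
move=> s t us vt; apply: hN.
  by case: su => _ _; apply.
by case: sv => _ _; apply.
Qed.

(** Every truncated sum has the required sign, and the sign survives the limit. The condition is
    stated term by term so that a coefficient of the wrong sign is allowed where the moments
    vanish. *)
Lemma bform_semidefinite u v A B (sg : R) : 0 < A -> seg_fun u A B -> seg_fun v A B ->
  (forall j, sg * bcoef k j * (moment j u ^+ 2 + moment j v ^+ 2) <= 0) ->
  sg * (bform u u + bform v v) <= 0.
Proof.
move=> A0 su sv hs.
pose I (f : R -> R) : R := Rintegral mu setT (fun x => `|f x|).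
have I0 (f : R -> R) : 0 <= I f by apply: Rintegral_ge0.
(* With precision e / D the total error is e (D - 1) / D; the summand 1 keeps D positive. *)
pose D := `|sg| * (I u ^+ 2 + I v ^+ 2) + 1.
have D0 : 0 < D by rewrite ltr_wpDl// mulr_ge0// addr_ge0// sqr_ge0.
apply/ler_addgt0Pr => e e0; rewrite add0r.
have eD : 0 < e / D by rewrite divr_gt0.
have [N hN] := bform_approx B A0 eD.
have hu := hN _ _ su su; have hv := hN _ _ sv sv.
rewrite -!expr2 in hu hv.
set Su := \sum_(j < N) _ in hu; set Sv := \sum_(j < N) _ in hv.
have S0 : sg * (Su + Sv) <= 0.
  rewrite /Su /Sv -big_split mulr_sumr /=; apply: sumr_le0 => j _.
  have -> : sg * ((2 + r) `^ (- k) * bcoef k j * (moment j u * moment j u) +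
     (2 + r) `^ (- k) * bcoef k j * (moment j v * moment j v)) =
     (2 + r) `^ (- k) * (sg * bcoef k j * (moment j u ^+ 2 + moment j v ^+ 2)) by ring.
  by rewrite mulr_ge0_le0// powR_ge0.
have : sg * (bform u u + bform v v) - sg * (Su + Sv) <= e.
  have -> : sg * (bform u u + bform v v) - sg * (Su + Sv) =
    sg * ((bform u u - Su) + (bform v v - Sv)) by ring.
  rewrite (le_trans (ler_norm _))// normrM.
  apply: (@le_trans _ _ (`|sg| * (e / D * I u ^+ 2 + e / D * I v ^+ 2))).
    by rewrite ler_wpM2l// (le_trans (ler_normD _ _))// lerD.
  have -> : `|sg| * (e / D * I u ^+ 2 + e / D * I v ^+ 2) = (e / D) * (D - 1) by rewrite /D; ring.
  rewrite -[leRHS](divfK (lt0r_neq0 D0)); apply: ler_wpM2l; first exact: ltW.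
  by rewrite lerBlDr lerDl.
lra.
Qed.

End hankel_kernel.

(** * Reduction to a real quadratic form and the upper bound for the index *)

Section quadratic_form.
Context {R : realType}.
Variables (r k alpha : R).
Hypothesis hr : 0 <= r.
Local Notation mu := (@lebesgue_measure R).
Implicit Types (f : R -> R[i]) (A B : R).

Local Notation hreal := (hreal r k alpha).
Local Notation bform := (bform r k alpha).

Definition re_part f t := complex.Re (f t).
Definition im_part f t := complex.Im (f t).

(** For a real symmetric kernel the cross terms between real and imaginary parts cancel, so this
    real number is the whole form. *)
Definition qform f := bform (re_part f) (re_part f) + bform (im_part f) (im_part f).

Lemma smooth_seg_fun (g : R -> R) A B : smooth g ->
  (forall t, g t != 0 -> A <= t <= B) -> seg_fun g A B.
Proof.
move=> sg gs; have cg := smooth_continuous sg.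
split => //; first exact: continuous_measurable_fun.
have [AB|BA] := lerP A B; last first.
  exists 0 => x; have [/gs|/negPn/eqP ->] := boolP (g x != 0); last by rewrite normr0.
  by move=> /andP[Ax xB]; move: (le_lt_trans (le_trans Ax xB) BA); rewrite ltxx.
have [|c _ hc] := @EVT_max _ (fun x => `|g x|) A B AB.
  by apply: continuous_subspaceT => x; apply: continuous_comp; [exact: cg|exact: norm_continuous].
exists `|g c| => x; have [/gs xAB|/negPn/eqP ->] := boolP (g x != 0).
  by apply: hc; rewrite in_itv.
by rewrite normr0.
Qed.

Lemma test_function_seg f : test_function R f -> exists2 A, 0 < A & exists B,
  seg_fun (re_part f) A B /\ seg_fun (im_part f) A B.
Proof.
move=> tf; have [A A0 [B fs]] := test_function_supp tf.
exists A => //; exists B.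
case: tf => sR sI _ _.
by split; apply: smooth_seg_fun => // t ft; apply: fs; apply: contra ft;
  rewrite /re_part /im_part => /eqP ->; rewrite eqxx.
Qed.

Lemma Re_conjM (x y : R[i]) : complex.Re (conjc x * y) =
  complex.Re x * complex.Re y + complex.Im x * complex.Im y.
Proof. by case: x => a b; case: y => c d /=; ring. Qed.

Lemma Im_conjM (x y : R[i]) : complex.Im (conjc x * y) =
  complex.Re x * complex.Im y - complex.Im x * complex.Re y.
Proof. by case: x => a b; case: y => c d /=; ring. Qed.

Lemma bform_symm u v A B : 0 < A -> seg_fun u A B -> seg_fun v A B ->
  bform u v = bform v u.
Proof.
move=> A0 su sv.
rewrite /bform /kform -(Rintegral_box_swap (box_fun_hreal k alpha hr A0 (box_fun_tensor su sv))).
by apply: eq_Rintegral => z _ /=; rewrite addrC /tensor /= [u _ * _]mulrC.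
Qed.

(** The product of conj f(s) and f(t - s) has real part a a + b b and imaginary part a b - b a,
    where f = a + i b. The first gives [qform]; the second is antisymmetric and integrates to 0
    against a symmetric kernel. *)
Lemma hankel_form_hpow f A B : 0 < A -> seg_fun (re_part f) A B ->
  seg_fun (im_part f) A B ->
  hankel_form (hpow r k alpha) f = (qform f)%:C%C.
Proof.
move=> A0 sa sb; set a := re_part f in sa *; set b := im_part f in sb *.
have baa := box_fun_tensor sa sa; have bbb := box_fun_tensor sb sb.
have bab := box_fun_tensor sa sb; have bba := box_fun_tensor sb sa.
rewrite /hankel_form /pairing /star /Cintegral /=.
have Haa := box_fun_hreal k alpha hr A0 baa.
have Hbb := box_fun_hreal k alpha hr A0 bbb.
have Hba := box_fun_hreal k alpha hr A0 bba.
have Hab := box_fun_hreal k alpha hr A0 bab.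
congr (_ +i* _)%C.
- pose W z := 1 * tensor a a z + tensor b b z.
  have bW : box_fun W A B := box_fun_lincomb 1 baa bbb.
  transitivity (Rintegral mu [set` `]0, +oo[]
    (fun t => hreal t * Rintegral mu [set` `[0, t]] (fun s => W (s, t - s)))).
    apply: eq_Rintegral => t _ /=; rewrite mul0r subr0; congr (_ * _).
    by apply: eq_Rintegral => s _; rewrite Re_conjM /W /tensor /= mul1r.
  rewrite (convolution_pairing A0 bW); last exact: box_fun_hreal.
  rewrite /qform /bform /kform -[X in _ = X + _]mul1r -(Rintegral_box_lincomb 1 Haa Hbb).
  by apply: eq_Rintegral => z _; rewrite /W; ring.
(* The antisymmetric part. The kernel is negated below because [pairing] conjugates the
   convolution. *)
- pose W z := -1 * tensor b a z + tensor a b z.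
  have bW : box_fun W A B := box_fun_lincomb (-1) bba bab.
  have bHW : box_fun (fun z => - hreal (z.1 + z.2) * W z) A B.
    rewrite (_ : (fun z => _) = (fun z => -1 * (hreal (z.1 + z.2) * tensor a b z) +
      hreal (z.1 + z.2) * tensor b a z)); last by apply/funext => z; rewrite /W; ring.
    exact: box_fun_lincomb.
  transitivity (Rintegral mu [set` `]0, +oo[]
    (fun t => - hreal t * Rintegral mu [set` `[0, t]] (fun s => W (s, t - s)))).
    apply: eq_Rintegral => t _ /=; rewrite mul0r addr0 mulrN [RHS]mulNr. congr (- _); congr (_ * _).
    apply: eq_Rintegral => s _; rewrite Im_conjM /W /tensor /= mulN1r addrC.
    by rewrite /a /b /re_part /im_part.
  rewrite (@convolution_pairing _ (fun t => - hreal t) W A B A0 bW bHW).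
  rewrite (_ : (fun z => _) = (fun z => -1 * (hreal (z.1 + z.2) * tensor a b z) +
    hreal (z.1 + z.2) * tensor b a z)); last by apply/funext => z; rewrite /W; ring.
  rewrite (Rintegral_box_lincomb _ Hab Hba) mulN1r.
  have := bform_symm A0 sa sb; rewrite /bform /kform => ->.
  by rewrite addNr.
Qed.

Lemma qform_ge0 f : k < 0 -> test_function R f ->
  0 <= hankel_form (hpow r k alpha) f.
Proof.
move=> k0 /test_function_seg[A A0 [B [sa sb]]].
rewrite (hankel_form_hpow A0 sa sb) ler0c -oppr_le0 -mulN1r.
apply: (bform_semidefinite hr A0 sa sb) => j.
rewrite mulN1r mulNr oppr_le0 mulr_ge0 ?addr_ge0 ?sqr_ge0//.
by rewrite ltW// bcoef_gt0.
Qed.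

(** Packing the two real moments into one complex number makes the moment linear over [R[i]], so
    that each index costs one complex dimension rather than two real conditions. *)
Definition cmoment j f : R[i] :=
  (moment r k alpha j (re_part f) +i* moment r k alpha j (im_part f))%C.

Lemma test_function_seg2 f g : test_function R f -> test_function R g ->
  exists2 A, 0 < A & exists B, [/\ seg_fun (re_part f) A B, seg_fun (im_part f) A B,
    seg_fun (re_part g) A B & seg_fun (im_part g) A B].
Proof.
move=> /test_function_seg[A A0 [B [sa sb]]] /test_function_seg[C C0 [D [sc sd]]].
exists (Num.min A C); first by rewrite lt_min A0.
exists (Num.max B D).
have mA : Num.min A C <= A by rewrite ge_min lexx.
have mC : Num.min A C <= C by rewrite ge_min lexx orbT.
have MB : B <= Num.max B D by rewrite le_max lexx.
have MD : D <= Num.max B D by rewrite le_max lexx orbT.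
by split; [apply: seg_fun_widen sa _ _|apply: seg_fun_widen sb _ _|
  apply: seg_fun_widen sc _ _|apply: seg_fun_widen sd _ _].
Qed.

Lemma cmoment_lincomb j (c : R[i]) f g : test_function R f -> test_function R g ->
  cmoment j (fun t => c * f t + g t) = c * cmoment j f + cmoment j g.
Proof.
move=> tf tg; have [A A0 [B [fa fb ga gb]]] := test_function_seg2 tf tg.
rewrite /cmoment.
have -> : re_part (fun t => c * f t + g t) = fun t => complex.Re c * re_part f t +
    (- complex.Im c * im_part f t + re_part g t).
  by apply/funext => t; rewrite /re_part /im_part; case: (f t) (g t) c => ? ? [? ?] [? ?] /=; ring.
have -> : im_part (fun t => c * f t + g t) = fun t => complex.Im c * re_part f t +
    (complex.Re c * im_part f t + im_part g t).
  by apply/funext => t; rewrite /re_part /im_part; case: (f t) (g t) c => ? ? [? ?] [? ?] /=; ring.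
rewrite !(@moment_lincomb _ r k alpha hr _ _ _ A B)//; try exact: seg_fun_lincomb.
by case: c => x y; apply/eqP; rewrite eq_complex /=; apply/andP; split; apply/eqP; ring.
Qed.

Lemma test_function0 : test_function R (fun=> 0).
Proof.
have s0 := @smooth0 R.
by apply: (@test_function_intro _ _ 1 1) => // t; rewrite eqxx.
Qed.

Lemma cmoment0 j : cmoment j (fun=> 0) = 0.
Proof.
have := @cmoment_lincomb j (-1) _ _ test_function0 test_function0.
have -> : (fun t : R => -1 * (0 : R[i]) + 0) = fun=> 0 by apply/funext => t; rewrite mulr0 addr0.
by rewrite mulN1r addNr.
Qed.

Lemma cmoment_sum j n (c : 'I_n -> R[i]) (v : 'I_n -> R -> R[i]^o) :
  (forall i, test_function R (v i)) ->
  test_function R (\sum_(i < n) c i *: v i) /\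
  cmoment j (\sum_(i < n) c i *: v i) = \sum_(i < n) c i * cmoment j (v i).
Proof.
move=> tv; pose P (g : R -> R[i]^o) x := test_function R g /\ cmoment j g = x.
have : P (\sum_(i < n) c i *: v i) (\sum_(i < n) c i * cmoment j (v i)).
  apply: (big_rec2 P); first by split; [exact: test_function0|exact: cmoment0].
  move=> i x g _ [tg <-]; split; first exact: test_function_lincomb.
  exact: cmoment_lincomb.
by [].
Qed.

(** With more vectors than indices in [J], the matrix of moments has more rows than columns. A
    nonzero row vector in its left kernel yields a nonzero element of [M] whose moments along [J]
    all vanish, and there the form has the wrong sign. *)
Lemma positive_dim_le (sg : R) (J : seq nat) (M : set (R -> R[i]^o)) n
    (v : 'I_n -> R -> R[i]^o) :
  (forall j, j \notin J -> sg * bcoef k j <= 0) ->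
  GRing.submod_closed [in M] -> M `<=` test_function R ->
  (forall f, M f -> f <> 0 -> 0 < sg * qform f) ->
  lin_indep v -> (forall i, M (v i)) -> (n <= size J)%N.
Proof.
move=> hJ [M0 Mlin] Mt Mpos vfree Mv; rewrite leqNgt; apply/negP => Jn.
pose X : 'M[R[i]]_(n, size J) := \matrix_(i, l) cmoment (nth 0 J l) (v i).
have : kermx X != 0.
  rewrite -mxrank_eq0 mxrank_ker subn_eq0 -ltnNge.
  exact: leq_ltn_trans (rank_leq_col X) Jn.
case/rowV0Pn => c /sub_kermxP cX c0.
pose f := \sum_(i < n) c ord0 i *: v i.
have Mf : M f.
  rewrite /f; apply: big_ind => [|f1 f2 h1 h2|i _].
  - by have := M0; rewrite inE.
  - by have := Mlin 1 f1 f2; rewrite !inE scale1r => /(_ h1 h2).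
  - by have := Mlin (c ord0 i) (v i) 0; rewrite !inE addr0 => /(_ (Mv i)); apply; have := M0; rewrite inE.
have fn0 : f <> 0.
  move=> /vfree h; move/eqP: c0; apply.
  by apply/rowP => i; rewrite mxE h.
have [A A0 [B [sa sb]]] := test_function_seg (Mt _ Mf).
have : sg * qform f <= 0.
  apply: (bform_semidefinite hr A0 sa sb) => j.
  have [jJ|jJ] := boolP (j \in J); last first.
    by rewrite mulr_le0_ge0 ?hJ// addr_ge0 ?sqr_ge0.
  have : cmoment j f = 0.
    rewrite (cmoment_sum j _ (fun i => Mt _ (Mv i))).2.
    have jJ' : (index j J < size J)%N by rewrite index_mem.
    have /rowP /(_ (Ordinal jJ')) := cX; rewrite !mxE => cX0; rewrite -[RHS]cX0.
    by apply: eq_bigr => i _; rewrite mxE nth_index.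
  by rewrite /cmoment => -[-> ->]; rewrite expr0n addr0 mulr0.
by apply/negP; rewrite -ltNge; exact: Mpos.
Qed.

End quadratic_form.

(** * Almost diagonal Gram matrices *)

Section point_masses.
Context {R : realType}.
Variables (r k alpha : R).
Hypothesis hr : 0 <= r.
Local Notation hreal := (hreal r k alpha).
Local Notation weight := (weight r k alpha).

Lemma weight_gt0 x : 0 < x -> 0 < weight x.
Proof. by have hr0 := hr => x0; rewrite mulr_gt0 ?expR_gt0// powR_gt0//; lra. Qed.

Lemma cayley_onto (p : R) : 0 <= p < 1 -> exists2 x, 0 < x & cayley r x = p.
Proof.
(* The witness solves (x - 1) / (x + 1 + r) = p for x. *)
have hr0 := hr; move=> /andP[p0 p1]; exists ((1 + (1 + r) * p) / (1 - p)).
  by rewrite divr_gt0//; [rewrite ltr_wpDr// mulr_ge0//; lra|lra].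
have p1' : 1 - p != 0 by rewrite gt_eqF//; lra.
have r2 : 2 + r != 0 by rewrite gt_eqF//; lra.
rewrite cayleyE//; last by rewrite divr_gt0//; [rewrite ltr_wpDr// mulr_ge0//; lra|lra].
have -> : (1 + (1 + r) * p) / (1 - p) + 1 + r = (2 + r) / (1 - p) by field.
by field; rewrite r2 p1'.
Qed.

(** Column j of [b] is the functional that reads the coefficient of degree j off the values at 0,
    ..., N - 1 of a polynomial of degree below N. *)
Lemma Vandermonde_inverse N : exists b : 'M[R]_N, forall i j : 'I_N,
  \sum_(l < N) (l%:R : R) ^+ i * b l j = (i == j)%:R.
Proof.
pose V : 'M[R]_N := Vandermonde N (\row_(l < N) l%:R).
have uV : V \in unitmx.
  rewrite unitmxE det_Vandermonde unitfE prodf_seq_neq0; apply/allP => i _ /=.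
  rewrite prodf_seq_neq0; apply/allP => j _; apply/implyP => ij; rewrite !mxE.
  by rewrite subr_eq0 eqr_nat eq_sym (ltn_eqF ij).
exists (invmx V) => i j.
have := congr1 (fun m : 'M[R]_N => m i j) (mulmxV uV); rewrite !mxE => <-.
by apply: eq_bigr => l _; rewrite !mxE.
Qed.

(** The coefficients divide out the weights, undo the scale rho^i of the nodes and invert the
    Vandermonde matrix. For the truncated kernel the Gram matrix is then exactly diagonal. The
    remainder, of order rho^(2N), is magnified by rho^(-i-j) with i, j < N, and so stays small with
    rho. *)
Lemma point_gram N (eta : R) : 0 < eta -> exists x : 'I_N -> R, exists a : 'I_N -> 'I_N -> R,
  (forall l, 0 < x l) /\ forall i j,
  `|\sum_(l < N) \sum_(m < N) a i l * a j m * hreal (x l + x m) -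
    (2 + r) `^ (- k) * bcoef k i * (i == j)%:R| <= eta.
Proof.
move=> eta0; have hr0 := hr.
have [b hb] := Vandermonde_inverse N.
have h01 : 0 < (1 / 2 : R) < 1 by lra.
have [C C0 hC] := binomial_remainder k h01.
pose kap := (2 + r) `^ (- k).
have kap0 : 0 < kap by rewrite powR_gt0//; lra.
pose E := C * (N%:R * `|bcoef k N| * (N%:R * N%:R) ^+ N).
have E0 : 0 <= E by rewrite !mulr_ge0 ?exprn_ge0 ?mulr_ge0// ltW.
pose S := \sum_(i < N) \sum_(l < N) `|b l i|.
have S0 i : \sum_(l < N) `|b l i| <= S.
  by rewrite /S [leRHS](bigD1 i)//= lerDl sumr_ge0// => j _; rewrite sumr_ge0.
have SS0 : 0 <= S by rewrite /S sumr_ge0// => j _; rewrite sumr_ge0.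
(* The first bound keeps all nodes in [0, 1/2], where the remainder estimate holds; the second makes
   the final error at most [eta]. *)
pose rho := Num.min (1 / (2 * N.+1%:R)) (eta / (kap * (S * S) * E + 1)).
have rho0 : 0 < rho.
  rewrite lt_min; apply/andP; split; first by rewrite divr_gt0// mulr_gt0.
  by rewrite divr_gt0// ltr_wpDl// !mulr_ge0// ltW.
have rhoN : rho * N.+1%:R <= 1 / 2.
  have -> : 1 / 2 = 1 / (2 * N.+1%:R) * N.+1%:R :> R by field; rewrite addrC natr1 pnatr_eq0.
  by rewrite ler_pM2r ?ltr0n// ge_min lexx.
have rhol (l : 'I_N) : 0 <= rho * l%:R <= 1 / 2.
  apply/andP; split; first by rewrite mulr_ge0// ltW.
  by apply: le_trans rhoN; rewrite ler_pM2l// ler_nat ltnW// ltnW// ltnS.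
have rho1 : rho <= 1.
  apply: (@le_trans _ _ (rho * N.+1%:R)); last lra.
  by apply: ler_peMr; [exact: ltW|rewrite ler1n].
have rhoeta : kap * (S * S) * E * rho <= eta.
  apply: (@le_trans _ _ ((kap * (S * S) * E + 1) * rho)); first by rewrite ler_pM2r// lerDl.
  rewrite mulrC -ler_pdivlMr; first by rewrite ge_min lexx orbT.
  by rewrite ltr_wpDl// !mulr_ge0// ltW.
have hx (l : 'I_N) : exists x, 0 < x /\ cayley r x = rho * l%:R.
  have [|x x0 xl] := @cayley_onto (rho * l%:R); last by exists x.
  by have := rhol l; lra.
have [x hxx] := choice hx.
have x0 l : 0 < x l by case: (hxx l).
have xl l : cayley r (x l) = rho * l%:R by case: (hxx l).
exists x, (fun i l => b l i * (rho ^+ i)^-1 / weight (x l)); split=> // i j.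
have rhoi (n : nat) : rho ^+ n != 0 by rewrite expf_neq0// gt_eqF.
have wx l : weight (x l) != 0 by rewrite gt_eqF// weight_gt0.
pose T (F : 'I_N -> 'I_N -> R) := \sum_(l < N) \sum_(m < N) b l i * b m j * F l m.
pose y (l m : 'I_N) := (rho * l%:R) * (rho * m%:R).
have -> : \sum_(l < N) \sum_(m < N) (b l i / rho ^+ i / weight (x l)) *
     (b m j / rho ^+ j / weight (x m)) * hreal (x l + x m) =
    kap / (rho ^+ i * rho ^+ j) * T (fun l m => (1 - y l m) `^ k).
  rewrite /T mulr_sumr; apply: eq_bigr => l _; rewrite mulr_sumr; apply: eq_bigr => m _.
  rewrite hreal_factor// !xl -/kap /y; field.
  by rewrite !rhoi !wx.
(* The truncated kernel: exchanging sums isolates for each n the factors delta_(n i) and delta_(n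
   j), so only n = i = j contributes. *)
have -> : kap * bcoef k i * (i == j)%:R =
    kap / (rho ^+ i * rho ^+ j) * T (fun l m => (bpoly k N).[y l m]).
  have -> : T (fun l m => (bpoly k N).[y l m]) =
      \sum_(n < N) bcoef k n * (rho ^+ n * rho ^+ n) *
        ((\sum_(l < N) l%:R ^+ n * b l i) * (\sum_(m < N) m%:R ^+ n * b m j)).
    rewrite /T; under eq_bigr => l _ do under eq_bigr => m _ do rewrite horner_bpoly mulr_sumr.
    under eq_bigr => l _ do rewrite exchange_big /=.
    rewrite exchange_big /=; apply: eq_bigr => n _.
    rewrite mulr_suml mulr_sumr; apply: eq_bigr => l _.
    rewrite mulr_sumr mulr_sumr; apply: eq_bigr => m _.
    by rewrite /y !exprMn; ring.
  pose W (n j' : 'I_N) : R := \sum_(l < N) l%:R ^+ n * b l j'.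
  have {}hb n j' : W n j' = (n == j')%:R := hb n j'.
  rewrite (eq_bigr (fun n : 'I_N => bcoef k n * (rho ^+ n * rho ^+ n) * (W n i * W n j)))//.
  rewrite (bigD1 i)//= big1 ?addr0; last first.
    by move=> n ni; rewrite hb (negbTE ni) mul0r mulr0.
  rewrite !hb eqxx mul1r; have [->|] := eqVneq i j; last by rewrite !mulr0.
  by field; rewrite rhoi.
rewrite -mulrBr.
have -> : T (fun l m => (1 - y l m) `^ k) - T (fun l m => (bpoly k N).[y l m]) =
   T (fun l m => (1 - y l m) `^ k - (bpoly k N).[y l m]).
  rewrite /T -sumrB; apply: eq_bigr => l _; rewrite -sumrB; apply: eq_bigr => m _.
  by rewrite mulrBr.
have Tle : `|T (fun l m => (1 - y l m) `^ k - (bpoly k N).[y l m])| <=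
    (S * S) * (E * (rho ^+ N * rho ^+ N)).
  apply: (@le_trans _ _ (\sum_(l < N) \sum_(m < N) `|b l i| * `|b m j| * (E * (rho ^+ N * rho ^+ N)))).
    rewrite (le_trans (ler_norm_sum _ _ _))// ler_sum// => l _.
    rewrite (le_trans (ler_norm_sum _ _ _))// ler_sum// => m _.
    rewrite !normrM ler_wpM2l ?mulr_ge0//.
    have /andP[l0 l1] := rhol l; have /andP[m0 m1] := rhol m.
    have y0 : 0 <= y l m by rewrite mulr_ge0.
    have ylm : `|y l m| <= 1 / 2.
      by rewrite ger0_norm// /y -[leRHS]mulr1 ler_pM//; lra.
    have N0 : (0 < N)%N by exact: leq_ltn_trans (ltn_ord l).
    rewrite distrC; apply: le_trans (hC N _ N0 ylm) _.
    have -> : E * (rho ^+ N * rho ^+ N) =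
        C * (N%:R * `|bcoef k N| * (N%:R * N%:R * (rho * rho)) ^+ N).
      by rewrite /E !exprMn; ring.
    apply: ler_wpM2l; first exact: ltW.
    apply: ler_wpM2l; first by rewrite mulr_ge0.
    have rr0 : 0 <= rho * rho by rewrite mulr_ge0// ltW.
    have y2 : `|y l m| <= N%:R * N%:R * (rho * rho).
      rewrite ger0_norm// /y.
      have -> : rho * l%:R * (rho * m%:R) = l%:R * m%:R * (rho * rho) by ring.
      by rewrite ler_wpM2r// ler_pM// ler_nat ltnW.
    by apply: lerXn2r => //; rewrite nnegrE// (le_trans _ y2).
  under eq_bigr => l _ do rewrite -mulr_suml -mulr_sumr.
  rewrite -mulr_suml -mulr_suml; apply: ler_wpM2r.
    by rewrite !mulr_ge0 ?exprn_ge0// ltW.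
  by apply: ler_pM => //; rewrite sumr_ge0.
rewrite normrM ger0_norm; last by rewrite divr_ge0 ?mulr_ge0 ?exprn_ge0 ?(ltW rho0) ?(ltW kap0).
apply: (@le_trans _ _ (kap / (rho ^+ i * rho ^+ j) * (S * S * (E * (rho ^+ N * rho ^+ N))))).
  by rewrite ler_wpM2l// divr_ge0 ?mulr_ge0 ?exprn_ge0 ?(ltW rho0) ?(ltW kap0).
(* Since [n < N], cancelling rho^n against rho^N leaves at least one factor rho. *)
have rN (n : 'I_N) : rho ^+ N = rho ^+ (N - n.+1) * rho * rho ^+ n.
  by rewrite -exprSr -exprD; congr (_ ^+ _); rewrite addSn -addnS subnK.
have -> : kap / (rho ^+ i * rho ^+ j) * (S * S * (E * (rho ^+ N * rho ^+ N))) =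
   kap * (S * S) * E * rho * (rho * (rho ^+ (N - i.+1) * rho ^+ (N - j.+1))).
  by rewrite {1}(rN i) (rN j); field; rewrite !rhoi.
apply: le_trans rhoeta; rewrite ler_piMr//.
  by rewrite !mulr_ge0// ltW.
by rewrite !mulr_ile1 ?mulr_ge0 ?exprn_ge0 ?exprn_ile1 ?(ltW rho0).
Qed.

End point_masses.

(** * From point masses to smooth functions *)

Section gram_matrix.
Context {R : realType}.
Variables (r k alpha : R).
Hypothesis hr : 0 <= r.
Local Notation mu := (@lebesgue_measure R).
Local Notation hreal := (hreal r k alpha).
Local Notation bform := (bform r k alpha).
Implicit Types (A B : R) (u v w : R -> R).

Lemma bump_seg_fun (c d : R) : seg_fun (bump c d) c d.
Proof.
by apply: smooth_seg_fun; [exact: smooth_bump|exact: bump_supp].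
Qed.

(** On the middle third the bump has a positive minimum, and the corresponding step function bounds
    it from below. *)
Lemma bump_mass_gt0 (c d : R) : c < d -> 0 < Rintegral mu setT (bump c d).
Proof.
move=> cd; pose c' := c + (d - c) / 3; pose d' := d - (d - c) / 3.
have cd' : c' < d' by rewrite /c' /d'; lra.
have [|z zcd hz] := @EVT_min _ (bump c d) c' d' (ltW cd').
  by apply: continuous_subspaceT; apply: smooth_continuous; exact: smooth_bump.
have z0 : 0 < bump c d z.
  rewrite bump_gt0; move: zcd; rewrite in_itv /= /c' /d' => /andP[h1 h2].
  by apply/andP; split; lra.
have mD : measurable (`[c', d']%classic : set R) by exact: measurable_itv.
pose g := (fun _ : R => bump c d z) \_ `[c', d'].
have gE x : g x = if c' <= x <= d' then bump c d z else 0.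
  rewrite /g patchE; case: ifPn; first by rewrite inE /= in_itv /= => ->.
  by rewrite notin_setE /= in_itv /= => /negP/negbTE ->.
have sg : seg_fun g c' d'.
  split.
  - by apply/(measurable_restrictT _ _).1 => //; exact: measurable_cst.
  - exists (bump c d z) => x; rewrite gE; case: ifP => _.
      by rewrite ger0_norm// ltW.
    by rewrite normr0 ltW.
  - by move=> x; rewrite gE; case: ifP => // _; rewrite eqxx.
apply: (@lt_le_trans _ _ (Rintegral mu setT g)).
  rewrite /g -Rintegral_mkcond Rintegral_cst//.
  have muE := @lebesgue_measure_itv R `[c', d'].
  rewrite /= lte_fin cd' -EFinB in muE.
  by rewrite [X in fine X]muE mulr_gt0//= subr_gt0.
apply: le_Rintegral => //; first exact: seg_fun_integrable sg.
  exact: seg_fun_integrable (bump_seg_fun c d).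
move=> x _; rewrite [leLHS]gE; case: ifP => [xcd|_]; last exact: bump_ge0.
by apply: hz; rewrite in_itv.
Qed.

Lemma hreal_continuous y : 0 < y -> {for y, continuous hreal}.
Proof.
have hr0 := hr; move=> y0; apply: continuousM.
  apply: (@continuous_comp _ _ _ (fun t : R => t + r) (fun t => t `^ k)).
    by apply: continuousD; [exact: cvg_id|exact: cvg_cst].
  have yr : 0 < y + r by lra.
  apply/differentiable_continuous/derivable1_diffP.
  by case: (is_derive1_powR k yr).
apply: (@continuous_comp _ _ _ (fun t : R => - alpha * t) expR).
  by apply: continuousM; [exact: cvg_cst|exact: cvg_id].
exact: continuous_expR.
Qed.

(** Bumps of mass 1 around the points turn the form into local averages of the kernel, which
    continuity brings close to its values at [x l + x m]. *)
Lemma smooth_bumps n (x : 'I_n -> R) (eta : R) : (forall l, 0 < x l) -> 0 < eta ->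
  exists2 A, 0 < A & exists B, exists phi : 'I_n -> R -> R,
  [/\ forall l, smooth (phi l), forall l, seg_fun (phi l) A B &
    forall l m, `|bform (phi l) (phi m) - hreal (x l + x m)| <= eta].
Proof.
move=> x0 eta0.
(* The radius [e]: the condition [e + e <= x l] keeps the supports in [e, +oo), and a sum of two
   points of the supports is within 2e of [x l + x m]. *)
have [e [e0 ex eh]] : exists e : R, [/\ 0 < e, forall l, e + e <= x l &
    forall l m t, `|x l + x m - t| <= e + e -> `|hreal t - hreal (x l + x m)| <= eta].
  have H1 : \forall e \near (0 : R)^'+, forall l : 'I_n, e + e <= x l.
    apply: filter_forall => l; near=> e.
    have : e <= x l / 2 by near: e; apply: nbhs_right_le; rewrite divr_gt0.
    lra.
  have H2 : \forall e \near (0 : R)^'+, forall l m : 'I_n,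
      forall t, `|x l + x m - t| <= e + e -> `|hreal t - hreal (x l + x m)| <= eta.
    apply: filter_forall => l; apply: filter_forall => m.
    have y0 : 0 < x l + x m by rewrite addr_gt0.
    have /cvgrPdist_le /(_ _ eta0) := hreal_continuous y0.
    rewrite -nbhs_ballE => -[d d0 hd]; near=> e.
    move=> t ht; rewrite distrC; apply: hd; rewrite /ball /=.
    apply: (le_lt_trans ht).
    have : e < d / 2 by near: e; apply: nbhs_right_lt; rewrite divr_gt0.
    lra.
  have [e [[e0 h1] h2]] : exists e : R, (0 < e /\ (forall l, e + e <= x l)) /\
    forall l m t, `|x l + x m - t| <= e + e -> `|hreal t - hreal (x l + x m)| <= eta.
    near ((0 : R)^'+) => e; exists e; split; first split.
    - by near: e; exact: nbhs_right_gt.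
    - by near: e.
    - by near: e.
  by exists e.
(* The points are positive, so their sum is a convenient common upper bound. *)
exists e => //; exists (\sum_l x l + e).
pose b l := bump (x l - e) (x l + e).
pose m l := Rintegral mu setT (b l).
have m0 l : 0 < m l by apply: bump_mass_gt0; lra.
pose phi l t := (m l)^-1 * b l t.
have xsum l : x l <= \sum_l x l.
  by rewrite (bigD1 l)//= lerDl sumr_ge0// => i _; rewrite ltW.
have phis l t : phi l t != 0 -> x l - e <= t <= x l + e.
  by rewrite mulf_eq0 negb_or => /andP[_]; exact: bump_supp.
have phi_smooth l : smooth (phi l).
  have := @smooth_lincomb R (m l)^-1 0 _ _ (@smooth_bump R (x l - e) (x l + e)) smooth0.
  by congr smooth; apply/funext => t; rewrite mulr0 addr0.
have sphi l : seg_fun (phi l) e (\sum_l x l + e).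
  apply: smooth_seg_fun => // t /phis /andP[h1 h2].
  by have h3 := ex l; have h4 := xsum l; apply/andP; split; lra.
have phi1 l : Rintegral mu setT (fun t => `|phi l t|) = 1.
  transitivity (Rintegral mu setT (phi l)).
    by apply: eq_Rintegral => t _; rewrite ger0_norm// mulr_ge0 ?bump_ge0// invr_ge0 ltW.
  rewrite RintegralZl//; first by rewrite mulVf// gt_eqF.
  exact: seg_fun_integrable (bump_seg_fun _ _).
have phi1' l : Rintegral mu setT (phi l) = 1.
  rewrite -(phi1 l); apply: eq_Rintegral => t _.
  by rewrite ger0_norm// mulr_ge0 ?bump_ge0// invr_ge0 ltW.
exists phi; split=> // l l'.
have bT := box_fun_tensor (sphi l) (sphi l').
have bH := box_fun_hreal k alpha hr e0 bT.
have bc : box_fun (fun z => hreal (x l + x l') * tensor (phi l) (phi l') z) e (\sum_l x l + e).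
  by apply: (@box_fun_mul _ (fun _ => _) _ _ _ `|hreal (x l + x l')|).
(* As the bumps have mass 1, the value of the kernel is itself the form of a constant kernel, and
   [kform_close] applies. *)
have -> : hreal (x l + x l') = kform (fun=> hreal (x l + x l')) (phi l) (phi l').
  rewrite /kform RintegralZl//; last exact: box_fun_integrable bT.
  by rewrite (Rintegral_tensor (sphi l) (sphi l')) !phi1' !mulr1.
have := kform_close (sphi l) (sphi l') bH bc (e := eta).
rewrite !phi1 !mulr1; apply => s t /phis /andP[h1 h2] /phis /andP[h3 h4].
by apply: eh; rewrite ler_norml /=; apply/andP; split; lra.
Unshelve. all: by end_near. Qed.

Definition lincomb n (a : 'I_n -> R) (phi : 'I_n -> R -> R) t : R := \sum_(l < n) a l * phi l t.

Lemma bform_lincombl (a : R) u v w A B : 0 < A -> seg_fun u A B -> seg_fun v A B ->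
  seg_fun w A B -> bform (fun t => a * u t + v t) w = a * bform u w + bform v w.
Proof.
move=> A0 su sv sw.
have bu := box_fun_hreal k alpha hr A0 (box_fun_tensor su sw).
have bv := box_fun_hreal k alpha hr A0 (box_fun_tensor sv sw).
rewrite /bform /kform -(Rintegral_box_lincomb a bu bv).
by apply: eq_Rintegral => z _; rewrite /tensor; ring.
Qed.

Lemma seg_fun0 A B : seg_fun (fun=> 0 : R) A B.
Proof.
split; [exact: measurable_cst|by exists 0 => t; rewrite normr0|].
by move=> t; rewrite eqxx.
Qed.

Lemma bform0l w : bform (fun=> 0) w = 0.
Proof.
rewrite /bform /kform (_ : (fun z => _) = cst 0) ?Rintegral_cst ?mul0r//.
by apply/funext => z; rewrite /tensor mul0r mulr0.
Qed.

Lemma bform_lincomb_seg n (a : 'I_n -> R) phi A B : 0 < A ->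
  (forall l, seg_fun (phi l) A B) ->
  seg_fun (lincomb a phi) A B /\
  forall w, seg_fun w A B -> bform (lincomb a phi) w = \sum_(l < n) a l * bform (phi l) w.
Proof.
move=> A0 sphi; rewrite /lincomb; elim: (index_enum _) => [|l s [ihs ih]].
  under [X in seg_fun X]eq_fun do rewrite big_nil.
  split; first exact: seg_fun0.
  by move=> w sw; under [X in bform X]eq_fun do rewrite big_nil; rewrite big_nil bform0l.
have E : (fun t => \sum_(l <- l :: s) a l * phi l t) =
   (fun t => a l * phi l t + \sum_(l <- s) a l * phi l t).
  by apply/funext => t; rewrite big_cons.
rewrite E; split; first exact: seg_fun_lincomb.
by move=> w sw; rewrite big_cons -ih// (bform_lincombl _ A0 (sphi l) ihs sw).
Qed.

Lemma bform_lincomb2 n (a b : 'I_n -> R) phi A B : 0 < A ->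
  (forall l, seg_fun (phi l) A B) ->
  bform (lincomb a phi) (lincomb b phi) =
  \sum_(l < n) \sum_(m < n) a l * b m * bform (phi l) (phi m).
Proof.
move=> A0 sphi; have [sa Ha] := bform_lincomb_seg a A0 sphi.
have [sb Hb] := bform_lincomb_seg b A0 sphi.
rewrite Ha//; apply: eq_bigr => l _.
rewrite (bform_symm k alpha hr A0 (sphi l) sb) Hb// mulr_sumr; apply: eq_bigr => m _.
by rewrite (bform_symm k alpha hr A0 (sphi m) (sphi l)); ring.
Qed.

Lemma smooth_lincomb_sum n (a : 'I_n -> R) phi : (forall l, smooth (phi l)) ->
  smooth (lincomb a phi).
Proof.
move=> sphi; rewrite /lincomb; elim: (index_enum _) => [|l s ih].
  under [X in smooth X]eq_fun do rewrite big_nil.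
  exact: smooth0.
have := @smooth_lincomb R (a l) 1 _ _ (sphi l) ih.
by congr smooth; apply/funext => t; rewrite big_cons mul1r.
Qed.

(** The coefficients of the point masses are applied to bumps; half of [eta] pays for each of the
    two approximations. *)
Lemma smooth_gram N (eta : R) : 0 < eta ->
  exists2 A, 0 < A & exists B, exists g : 'I_N -> R -> R,
  [/\ forall i, smooth (g i), forall i, seg_fun (g i) A B & forall i j,
  `|bform (g i) (g j) - (2 + r) `^ (- k) * bcoef k i * (i == j)%:R| <= eta].
Proof.
move=> eta0; have eta2 : 0 < eta / 2 by rewrite divr_gt0.
have [x [a [x0 ha]]] := point_gram k alpha hr N eta2.
pose S := \sum_(i < N) \sum_(l < N) `|a i l|.
have S0 i : \sum_(l < N) `|a i l| <= S.
  by rewrite /S [leRHS](bigD1 i)//= lerDl sumr_ge0// => j _; rewrite sumr_ge0.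
have SS0 : 0 <= S by rewrite /S sumr_ge0// => j _; rewrite sumr_ge0.
have S1 : 0 < S * S + 1 by rewrite ltr_wpDl// mulr_ge0.
(* The coefficients have absolute sums at most [S], so an entrywise error of this size adds up to at
   most eta / 2. *)
have eta3 : 0 < eta / 2 / (S * S + 1) by rewrite divr_gt0.
have [A A0 [B [phi [sm sphi hphi]]]] := smooth_bumps x0 eta3.
exists A => //; exists B, (fun i => lincomb (a i) phi); split=> [i|i|i j].
- exact: smooth_lincomb_sum.
- by case: (bform_lincomb_seg (a i) A0 sphi).
rewrite (bform_lincomb2 _ _ A0 sphi).
have := ha i j; set G := \sum_(l < N) _; set T := \sum_(l < N) _ => hT.
have GT : `|T - G| <= eta / 2.
  rewrite /T /G -sumrB.
  apply: (@le_trans _ _ (\sum_(l < N) \sum_(m < N) `|a i l| * `|a j m| * (eta / 2 / (S * S + 1)))).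
    rewrite (le_trans (ler_norm_sum _ _ _))// ler_sum// => l _.
    rewrite -sumrB (le_trans (ler_norm_sum _ _ _))// ler_sum// => m _.
    by rewrite -mulrBr !normrM ler_wpM2l ?mulr_ge0.
  under eq_bigr => l _ do rewrite -mulr_suml -mulr_sumr.
  rewrite -mulr_suml -mulr_suml.
  apply: (@le_trans _ _ (S * S * (eta / 2 / (S * S + 1)))).
    by apply: ler_wpM2r; [exact: ltW|apply: ler_pM => //; rewrite sumr_ge0].
  rewrite mulrA ler_pdivrMr// mulrC ler_pM2l//.
  by rewrite lerDl.
move: hT GT; set D := _ * _ * _; rewrite !ler_norml => /andP[h1 h2] /andP[h3 h4].
by apply/andP; split; lra.
Qed.

End gram_matrix.

(** * Inertia *)

(** By |x_i x_j| <= (x_i^2 + x_j^2) / 2, entrywise errors of size eta cost at most eta n times the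
    sum of the squares. *)
Lemma near_diagonal_ge (R : realType) n (G : 'I_n -> 'I_n -> R) (d x : 'I_n -> R) (delta eta : R) :
  0 <= eta -> (forall i, delta <= d i) ->
  (forall i j, `|G i j - d i * (i == j)%:R| <= eta) ->
  (delta - eta * n%:R) * \sum_(i < n) x i ^+ 2 <= \sum_(i < n) \sum_(j < n) x i * x j * G i j.
Proof.
move=> eta0 hd hG; set X := \sum_(i < n) x i ^+ 2.
have -> : \sum_(i < n) \sum_(j < n) x i * x j * G i j =
  \sum_(i < n) d i * x i ^+ 2 +
  \sum_(i < n) \sum_(j < n) x i * x j * (G i j - d i * (i == j)%:R).
  rewrite -big_split; apply: eq_bigr => i _ /=.
  have -> : d i * x i ^+ 2 = \sum_(j < n) x i * x j * (d i * (i == j)%:R).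
    rewrite (bigD1 i)//= big1 ?addr0; first by rewrite eqxx mulr1; ring.
    by move=> j ji; rewrite eq_sym (negbTE ji) !mulr0.
  by rewrite -big_split; apply: eq_bigr => j _ /=; ring.
have h1 : delta * X <= \sum_(i < n) d i * x i ^+ 2.
  by rewrite /X mulr_sumr ler_sum// => i _; rewrite ler_wpM2r// sqr_ge0.
have XX : \sum_(i < n) \sum_(j < n) (x i ^+ 2 + x j ^+ 2) / 2 = n%:R * X.
  under eq_bigr => i _ do rewrite -mulr_suml big_split /= sumr_const card_ord -/X.
  rewrite -mulr_suml big_split /= sumr_const card_ord sumrMnl.
  by rewrite -/X -[X *+ n]mulr_natl mulrDl -splitr.

have h2 : `|\sum_(i < n) \sum_(j < n) x i * x j * (G i j - d i * (i == j)%:R)| <= eta * (n%:R * X).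
  rewrite -XX mulr_sumr (le_trans (ler_norm_sum _ _ _))// ler_sum// => i _.
  rewrite mulr_sumr (le_trans (ler_norm_sum _ _ _))// ler_sum// => j _.
  rewrite normrM [leRHS]mulrC ler_pM// normrM -[x i ^+ 2]real_normK ?num_real//.
  rewrite -[x j ^+ 2]real_normK ?num_real//.
  have := sqr_ge0 (`|x i| - `|x j|); lra.
move: h2; rewrite ler_norml => /andP[h2 _].
by rewrite mulrBl -mulrA; lra.
Qed.

Section inertia.
Context {R : realType}.
Variables (r k alpha : R).
Hypothesis hr : 0 <= r.
Local Notation bform := (bform r k alpha).
Local Notation qform := (qform r k alpha).
Implicit Types (f : R -> R[i]^o) (J : seq nat) (sg : R).

(** Positivity is claimed for every nonzero coefficient vector, not only for nonzero combinations;
    linear independence of the family will follow from it. *)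
Lemma positive_family sg J : `|sg| <= 1 -> uniq J ->
  (forall j, j \in J -> 0 < sg * bcoef k j) ->
  exists2 v : 'I_(size J) -> R -> R[i]^o, forall i, test_function R (v i) &
  forall c : 'I_(size J) -> R[i], (exists i, c i != 0) ->
    0 < sg * qform (\sum_(i < size J) c i *: v i).
Proof.
move=> sg1 uJ posJ; have hr0 := hr.
set n := size J.
pose kap := (2 + r) `^ (- k).
have kap0 : 0 < kap by rewrite powR_gt0//; lra.
have [delta delta0 hdelta] : exists2 delta, 0 < delta &
    forall j, j \in J -> delta <= sg * (kap * bcoef k j).
  have {posJ}posJ j : j \in J -> 0 < sg * (kap * bcoef k j).
    by move=> /posJ h; rewrite mulrCA mulr_gt0.
  elim: (J) posJ => [|j s ih] posJ; first by exists 1.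
  have [|d d0 hd] := ih; first by move=> i si; apply: posJ; rewrite inE si orbT.
  exists (Num.min d (sg * (kap * bcoef k j))).
    by rewrite lt_min d0 posJ// inE eqxx.
  move=> i; rewrite inE => /predU1P[->|/hd h]; first by rewrite ge_min lexx orbT.
  by rewrite ge_min h.
(* All elements of [J] lie below [N], so [J] selects a principal submatrix of the almost diagonal
   Gram matrix. *)
pose N := (\max_(j <- J) j).+1.
have JN (i : 'I_n) : (nth 0 J i < N)%N.
  by rewrite ltnS; apply: leq_bigmax_seq => //; exact: mem_nth.
pose tau (i : 'I_n) : 'I_N := Ordinal (JN i).
have tau_eq i j : (tau i == tau j) = (i == j).
  by rewrite -val_eqE /= nth_uniq.
(* Dividing by n + 1 rather than n keeps delta - eta n strictly positive and covers an empty [J]. *)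
pose eta := delta / n.+1%:R.
have eta0 : 0 < eta by rewrite divr_gt0.
have etan : 0 < delta - eta * n%:R.
  rewrite subr_gt0 /eta mulrAC ltr_pdivrMr// ltr_pM2l// ltr_nat//.
have [A A0 [B [g [sm sgN hg]]]] := smooth_gram k alpha hr N eta0.
pose w i := g (tau i).
have seg_w i : seg_fun (w i) A B by exact: sgN.
exists (fun i t => (w i t)%:C%C).
  move=> i; apply: (@test_function_intro _ _ A B) => //=.
  - exact: sm.
  - exact: smooth0.
  - move=> t h; case: (seg_w i) => _ _; apply.
    by apply: contra h => /eqP ->.
move=> c [i0 ci0]; set f := \sum_(i < n) _.
have fE t : f t = (lincomb (fun i => complex.Re (c i)) w t +i*
                   lincomb (fun i => complex.Im (c i)) w t)%C.
  rewrite /f fct_sumE /lincomb.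
  elim/big_rec3: _ => // i x y z _ ->.
  rewrite /GRing.scale /=.
  by case: (c i) => p q; apply/eqP; rewrite eq_complex /=; apply/andP; split; apply/eqP; ring.
have -> : qform f = bform (lincomb (fun i => complex.Re (c i)) w) (lincomb (fun i => complex.Re (c i)) w)
   + bform (lincomb (fun i => complex.Im (c i)) w) (lincomb (fun i => complex.Im (c i)) w).
  rewrite /qform.
  have -> : re_part f = lincomb (fun i => complex.Re (c i)) w by apply/funext => t; rewrite /re_part fE.
  by have -> : im_part f = lincomb (fun i => complex.Im (c i)) w by apply/funext => t; rewrite /im_part fE.
rewrite !(bform_lincomb2 k alpha hr _ _ A0 seg_w) mulrDr.
have Q (x : 'I_n -> R) : (delta - eta * n%:R) * \sum_(i < n) x i ^+ 2 <=
    sg * \sum_(l < n) \sum_(m < n) x l * x m * bform (w l) (w m).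
  rewrite (_ : sg * _ = \sum_(l < n) \sum_(m < n) x l * x m * (sg * bform (w l) (w m))); last first.
    rewrite mulr_sumr; apply: eq_bigr => l _; rewrite mulr_sumr; apply: eq_bigr => m _.
    by ring.
  apply: (@near_diagonal_ge _ _ _ (fun i => sg * (kap * bcoef k (tau i)))) => [|i|i j].
  - exact: ltW.
  - by apply: hdelta; rewrite mem_nth.
  - rewrite -tau_eq -mulrA -mulrBr normrM -[leRHS]mul1r ler_pM//.
    exact: hg.
apply: (@lt_le_trans _ _ ((delta - eta * n%:R) *
    (\sum_(i < n) complex.Re (c i) ^+ 2 + \sum_(i < n) complex.Im (c i) ^+ 2))).
  rewrite mulr_gt0// -big_split (bigD1 i0)//=.
  apply: ltr_pwDl; last by apply: sumr_ge0 => i _; rewrite addr_ge0 ?sqr_ge0.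
  rewrite lt0r addr_ge0 ?sqr_ge0// andbT paddr_eq0 ?sqr_ge0// !sqrf_eq0.
  by move: ci0; rewrite eq_complex.
by rewrite mulrDr lerD.
Qed.

(** [Nplus] and [Nminus] are instances of it by unfolding, for [Q] the form and its opposite, so
    both signs are treated at once. *)
Definition inertia_index (Q : (R -> R[i]^o) -> R[i]) : \bar R :=
  ereal_sup [set dimension R M | M in
    [set M : set (R -> R[i]^o) | [/\ GRing.submod_closed [in M],
       M `<=` test_function R &
       forall f, M f -> f <> 0 -> 0 < Q f] ] ].

Lemma inertia_index_le Q sg J :
  (forall f, test_function R f -> 0 < Q f -> 0 < sg * qform f) ->
  (forall j, j \notin J -> sg * bcoef k j <= 0) ->
  (inertia_index Q <= (size J)%:R%:E)%E.
Proof.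
move=> HQ hJ; apply: ge_ereal_sup => _ [M [Mlin Mt Mpos] <-].
apply: ge_ereal_sup => _ [n [v vfree Mv] <-].
rewrite lee_fin ler_nat.
apply: (positive_dim_le hr hJ Mlin Mt _ vfree Mv) => f Mf f0.
by apply: HQ; [exact: Mt|exact: Mpos].
Qed.

(** The extremal space is the span of the family from [positive_family]. *)
Lemma inertia_index_ge Q sg J : `|sg| <= 1 ->
  (forall f, test_function R f -> 0 < sg * qform f -> 0 < Q f) ->
  uniq J -> (forall j, j \in J -> 0 < sg * bcoef k j) ->
  ((size J)%:R%:E <= inertia_index Q)%E.
Proof.
move=> sg1 HQ uJ posJ; have [v vt vpos] := positive_family sg1 uJ posJ.
pose n := size J.
pose M : set (R -> R[i]^o) := [set f | exists c : 'I_n -> R[i], f = \sum_(i < n) c i *: v i].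
have Mt : M `<=` test_function R.
  by move=> _ [c ->]; case: (cmoment_sum k alpha hr 0 c vt).
have cn0 (c : 'I_n -> R[i]) : \sum_(i < n) c i *: v i <> 0 -> exists i, c i != 0.
  move=> f0; apply: contrapT => h; apply: f0; apply: big1 => i _.
  have [->|ci] := eqVneq (c i) 0; first by rewrite scale0r.
  by exfalso; apply: h; exists i.
have MS : [set M : set (R -> R[i]^o) | [/\ GRing.submod_closed [in M], M `<=` test_function R &
       forall f, M f -> f <> 0 -> 0 < Q f] ] M.
  split => //.
    split; first by rewrite inE; exists (fun=> 0); rewrite big1// => i _; rewrite scale0r.
    move=> a f g; rewrite !inE => -[c ->] [d ->]; exists (fun i => a * c i + d i).
    rewrite scaler_sumr -big_split; apply: eq_bigr => i _ /=.
    by rewrite scalerDl scalerA.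
  by move=> f Mf f0; apply: HQ; [exact: Mt|move: Mf f0 => [c ->] /cn0; exact: vpos].
apply: (@le_trans _ _ (dimension R M)); last by apply: ereal_sup_ubound; exists M.
apply: ereal_sup_ubound; exists n => //; exists v.
  (* A vanishing combination with a nonzero coefficient would make the form of 0 positive. *)
  move=> c c0 i; apply: contrapT => /eqP ci.
  have := vpos c (ex_intro _ i ci); rewrite c0.
  rewrite /qform (_ : re_part 0 = fun=> 0)// (_ : im_part 0 = fun=> 0)//.
  by rewrite !bform0l addr0 mulr0 ltxx.
move=> i; exists (fun j => (j == i)%:R).
rewrite (bigD1 i)//= eqxx scale1r big1 ?addr0// => j /negbTE ->.
by rewrite scale0r.
Qed.

Lemma hankel_form_test f : test_function R f ->
  hankel_form (hpow r k alpha) f = (qform f)%:C%C.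
Proof. by move=> /test_function_seg[A A0 [B [sa sb]]]; exact: hankel_form_hpow sa sb. Qed.

End inertia.

(** The indices j <= n with the parity of n, which are those where b_j has the sign (-1)^n: the
    index n + 1 has the other parity, and its sign persists. *)
Definition parity_seq n : seq nat := [seq (i.*2 + odd n)%N | i <- iota 0 n./2.+1].

Lemma size_parity_seq n : size (parity_seq n) = (n./2 + 1)%N.
Proof. by rewrite size_map size_iota addn1. Qed.

Lemma mem_parity_seq n j : (j \in parity_seq n) = (j <= n)%N && (odd j == odd n).
Proof.
apply/mapP/andP => [[m]|[jn /eqP oj]].
  rewrite mem_iota add0n ltnS => /andP[_ mn] ->.
  rewrite oddD odd_double /= oddb eqxx; split=> //.
  by rewrite -[leqRHS]odd_double_half addnC leq_add2l leq_double.
exists j./2; first by rewrite mem_iota add0n ltnS half_leq.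
by rewrite -oj addnC odd_double_half.
Qed.

Lemma uniq_parity_seq n : uniq (parity_seq n).
Proof.
rewrite map_inj_uniq ?iota_uniq// => i j /addIn /(congr1 half).
by rewrite !doubleK.
Qed.

(** * The two indices for n < k < n + 1 *)

Section inertia_of_powers.
Context {R : realType}.
Variables (r k alpha : R) (n : nat).
Hypotheses (hr : 0 <= r) (nk : n%:R < k < n.+1%:R).
Local Notation qform := (qform r k alpha).
Implicit Types Q : (R -> R[i]^o) -> R[i].

Lemma finite_inertia Q :
  (forall f, test_function R f -> (0 < Q f) = (0 < (-1) ^+ n * qform f)) ->
  inertia_index Q = (n./2 + 1)%:R%:E.
Proof.
move=> HQ; have /andP[nk1 _] := nk; rewrite -size_parity_seq.
apply/eqP; rewrite eq_le; apply/andP; split.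
  apply: (inertia_index_le (k := k) (alpha := alpha) hr (sg := (-1) ^+ n)).
    by move=> f tf; rewrite HQ.
  move=> j; rewrite mem_parity_seq negb_and -ltnNge.
  (* Off the list, an index either exceeds n, where the sign is (-1)^(n+1), or is at most n with the
     other parity, where (-1)^j is again the opposite sign. *)
  case: (ltnP n j) => [nj _|jn /= oj].
    have := bcoef_eventual_sign nk nj; rewrite exprS mulN1r mulNr oppr_gt0; exact: ltW.
  have := bcoef_alternating nk1 (leqW jn).
  rewrite -signr_odd -(signr_odd _ n); move: oj.
  by case: (odd j) (odd n) => -[] //= _; rewrite ?expr0 ?expr1 ?mulN1r ?mul1r ?oppr_gt0 ?oppr_le0 => /ltW.
apply: (inertia_index_ge (k := k) (alpha := alpha) hr (sg := (-1) ^+ n)).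
- by rewrite normrX normrN1 expr1n.
- by move=> f tf; rewrite HQ.
- exact: uniq_parity_seq.
move=> j; rewrite mem_parity_seq => /andP[jn /eqP oj].
by rewrite -signr_odd -oj signr_odd; apply: (bcoef_alternating nk1); exact: leqW.
Qed.

(** All indices beyond n carry the sign (-1)^(n+1), so arbitrarily long blocks of them are
    available. *)
Lemma infinite_inertia Q :
  (forall f, test_function R f -> (0 < Q f) = (0 < (-1) ^+ n.+1 * qform f)) ->
  inertia_index Q = +oo%E.
Proof.
move=> HQ; apply/eqyP => A A0.
pose m := (Num.truncn A).+1.
apply: (@le_trans _ _ (m%:R%:E)).
  by rewrite lee_fin ltW// truncnS_gt.
rewrite -(size_iota n.+1 m).
apply: (inertia_index_ge (k := k) (alpha := alpha) hr (sg := (-1) ^+ n.+1)).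
- by rewrite normrX normrN1 expr1n.
- by move=> f tf; rewrite HQ.
- exact: iota_uniq.
by move=> j; rewrite mem_iota => /andP[nj _]; exact: bcoef_eventual_sign.
Qed.

End inertia_of_powers.

Theorem theorem6p5 (R : realType) (alpha r k : R) (hr : 0 <= r) :
  (k < 0 -> forall f : R -> R[i], test_function R f ->
     0 <= hankel_form (hpow r k alpha) f) /\
  (0 < k -> k \isn't a Num.nat ->
     (~~ odd (Num.truncn k) ->
        Nplus (hpow r k alpha) = ((Num.truncn k)./2 + 1)%:R%:E /\
        Nminus (hpow r k alpha) = +oo%E) /\
     (odd (Num.truncn k) ->
        Nminus (hpow r k alpha) = ((Num.truncn k + 1)./2)%:R%:E /\
        Nplus (hpow r k alpha) = +oo%E)).
Proof.
split=> [k0 f tf|k0 kN]; first exact: qform_ge0.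
set n := Num.truncn k.
(* The lower inequality is strict because k is not a natural number. *)
have nk : n%:R < k < n.+1%:R.
  have /andP[nk kn] := truncn_itv (ltW k0).
  rewrite kn andbT lt_neqAle nk andbT.
  by apply: contra kN => /eqP <-; exact: natr_nat.
(* The explicit factor is the value of the sign power to which this will be matched once the parity
   of [n] is known. *)
have HP f : test_function R f ->
    (0 < hankel_form (hpow r k alpha) f) = (0 < 1 * qform r k alpha f).
  by move=> tf; rewrite (hankel_form_test k alpha hr tf) mul1r ltcR.
have HM f : test_function R f ->
    (0 < - hankel_form (hpow r k alpha) f) = (0 < -1 * qform r k alpha f).
  by move=> tf; rewrite (hankel_form_test k alpha hr tf) mulN1r -rmorphN ltcR.
split=> n_odd; split.
- apply: (finite_inertia (alpha := alpha) hr nk) => f tf.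
  by rewrite -signr_odd (negbTE n_odd) expr0 HP.
- apply: (infinite_inertia (alpha := alpha) hr nk) => f tf.
  by rewrite -signr_odd /= n_odd expr1 HM.
(* For odd n the stated value (n + 1) / 2 is the same count [n / 2] + 1 as in the even case. *)
- have -> : ((n + 1)./2 = n./2 + 1)%N by rewrite !addn1 /= uphalf_half n_odd.
  apply: (finite_inertia (alpha := alpha) hr nk) => f tf.
  by rewrite -signr_odd n_odd expr1 HM.
- apply: (infinite_inertia (alpha := alpha) hr nk) => f tf.
  by rewrite -signr_odd /= n_odd expr0 HP.
Qed.
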